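(* Let $n\geq1$, $r=2^n$ and $M=34^{2^n}+1$. Let $\pi=1+\zeta_{17}^2+\zeta_{17}^9\in\mathbb{Z}[\zeta_{34}]$ and $\alpha=(\pi/\bar\pi)^{\tau}$, where $\tau=1+3\sigma_{-11}+5\sigma_7+7\sigma_5+9\sigma_{-15}+11\sigma_{-3}+13\sigma_{-13}+15\sigma_{-9}$. For $k\ge0$ and $1\leq j\leq8$ define $S_k^{(j)}=f^{(j)}(\alpha_1^{(k)},\ldots,\alpha_8^{(k)})$, where $f^{(j)}$ is the $j$-th elementary symmetric polynomial in $8$ variables, $\alpha_1^{(k)}=\alpha^{34^k}+\bar\alpha^{34^k}$, and $\alpha_i^{(k)}=\sigma_{2i-1}(\alpha_1^{(k)})$ for $2\leq i\leq8$. Suppose that every integer $x$ with $1<x<17^r$ and $x^{16}\equiv1\pmod{17^r}$ does not divide $M$. Then $M$ is prime if and only if one of the following holds: (i) $M$ is congruent modulo $103$ to one of $-21,\ 15$, and $S_{r-1}^{(1)}\equiv-1$, $S_{r-1}^{(2)}\equiv-7$, $S_{r-1}^{(3)}\equiv6$, $S_{r-1}^{(4)}\equiv15$, $S_{r-1}^{(5)}\equiv-10$, $S_{r-1}^{(6)}\equiv-10$, $S_{r-1}^{(7)}\equiv4$, $S_{r-1}^{(8)}\equiv1\pmod M$; (ii) $M$ is congruent modulo $103$ to one of $35,\ 24,\ -2,\ -9,\ 10,\ -30$, and $S_{r-1}^{(1)}\equiv1$, $S_{r-1}^{(2)}\equiv-7$, $S_{r-1}^{(3)}\equiv-6$, $S_{r-1}^{(4)}\equiv15$,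 $S_{r-1}^{(5)}\equiv10$, $S_{r-1}^{(6)}\equiv-10$, $S_{r-1}^{(7)}\equiv-4$, $S_{r-1}^{(8)}\equiv1\pmod M$.
   Context: $\zeta_m=e^{2\pi\sqrt{-1}/m}$ and a bar denotes complex conjugation. For $c$ coprime to $34$, $\sigma_c\in G=\mathrm{Gal}(\mathbb{Q}(\zeta_{34})/\mathbb{Q})$ sends $\zeta_{34}$ to $\zeta_{34}^c$; $1$ denotes $\sigma_1$ in $\mathbb{Z}[G]$. For $\tau=\sum_{\sigma\in G}k_\sigma\sigma\in\mathbb{Z}[G]$ and $\beta\neq0$, $\beta^\tau:=\prod_{\sigma}\sigma(\beta)^{k_\sigma}$. The $S_k^{(j)}$ are rational numbers with denominators prime to $M$; congruences modulo $M$ are understood in the ring of rationals with denominator prime to $M$. *)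

(* Defs.v *)
From HB Require Import structures.
From mathcomp Require Import all_boot all_order all_algebra all_fingroup all_field.
From mathcomp Require Import reals trigo.
From mathcomp Require Import complex.
From mathcomp Require mpoly.

Set Implicit Arguments.
Unset Strict Implicit.
Unset Printing Implicit Defensive.

Import Order.TTheory GRing.Theory Num.Theory.
Local Open Scope ring_scope.

Definition zetaC (R : realType) (m : nat) : R[i] :=
  (cos (2 * pi / m%:R) +i* sin (2 * pi / m%:R))%C.

(* Additive group of Z[G] for G = Gal(L/Q): tau is identified with the family
   of its coefficients. *)
Definition galring (L : splittingFieldType rat) : zmodType :=
  {ffun gal_of {:L} -> int}.

Definition galring_elt (L : splittingFieldType rat) (s : gal_of {:L}) :
    galring L :=
  [ffun t => (t == s)%:Z].

Definition galring_exp (L : splittingFieldType rat) (b : L) (tau : galring L) :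
    L :=
  \prod_(s in 'Gal({:L} / 1)%g) s b ^ (tau s).

(* The ring of rationals with denominator prime to M. *)
Definition prime_to_denq (M : nat) (q : rat) : bool := coprime `|denq q| M.

(* x = a (mod M) in that ring, for x in a field containing Q. *)
Definition eqmodQ (L : splittingFieldType rat) (M : nat) (x : L) (a : int) :
    Prop :=
  exists q t : rat, [/\ x = q%:A, prime_to_denq M q, prime_to_denq M t
                      & q - a%:~R = M%:R * t].

Definition Mn (n : nat) : nat := (34 ^ (2 ^ n) + 1)%N.

(* In the definitions below z stands for zeta_34, so that zeta_17 = z ^+ 2,
   bar for complex conjugation on L = Q(z), and sigma c for sigma_c. *)

Definition pi_ (L : splittingFieldType rat) (z : L) : L :=
  let z17 := z ^+ 2 in 1 + z17 ^+ 2 + z17 ^+ 9.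

Definition tau_ (L : splittingFieldType rat) (sigma : int -> gal_of {:L}) :
    galring L :=
  let s c := galring_elt (sigma c) in
  s 1 + s (-11) *+ 3 + s 7 *+ 5 + s 5 *+ 7 + s (-15) *+ 9
  + s (-3) *+ 11 + s (-13) *+ 13 + s (-9) *+ 15.

Definition alpha (L : splittingFieldType rat) (z : L) (bar : L -> L)
    (sigma : int -> gal_of {:L}) : L :=
  galring_exp (pi_ z / bar (pi_ z)) (tau_ sigma).

(* The index is shifted: i : 'I_8 represents the index i + 1 of 1, ..., 8, and
   2 (i + 1) - 1 = 2 i + 1. *)
Definition alpha_ (L : splittingFieldType rat) (z : L) (bar : L -> L)
    (sigma : int -> gal_of {:L}) (k : nat) (i : 'I_8) : L :=
  let a := alpha z bar sigma in
  sigma (2 * i + 1)%N (a ^+ (34 ^ k) + bar a ^+ (34 ^ k)).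

Definition S_ (L : splittingFieldType rat) (z : L) (bar : L -> L)
    (sigma : int -> gal_of {:L}) (k j : nat) : L :=
  mpoly.meval (alpha_ z bar sigma k) (mpoly.mesym 8 L j).

(* Main.v *)
Require Import Defs.
From HB Require Import structures.
From Stdlib Require Import ZArith.
From mathcomp Require Import all_boot all_order all_algebra.
From mathcomp Require Import all_fingroup all_solvable all_field.
From mathcomp Require Import ssrZ zify ring.
From mathcomp Require Import reals trigo.
From mathcomp Require Import complex.
From mathcomp Require Import mpoly.

Set Implicit Arguments.
Unset Strict Implicit.
Unset Printing Implicit Defensive.

Import Order.TTheory GRing.Theory Num.Theory.
Local Open Scope ring_scope.

(** Everything takes place in finite fields K containing a root of unity w of
    order 34.  If M is prime, K of characteristic M also contains roots of unity
    of order 103.  Let g be the Gauss sum in K of the character chi of order 34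
    modulo 103.  The Frobenius gives g^(M-1) = chi(M)^-1, and M - 1 = 34^r.  By
    Stickelberger, g^34 is an explicit product of conjugates of pi, namely a root
    of unity times alpha times a 34-th power, so alpha^(34^(r-1)) reduces to
    chi(M)^-1.  This is a root of unity of order 17 or 34 according to M modulo
    103, which gives the congruences for the symmetric functions.
    Conversely, let l be a prime factor of M.  The congruences force
    alpha^(34^(r-1)) to have order 17 or 34 in K of characteristic l, so 17^r
    divides the order of alpha, which divides l^16 - 1 because alpha lies in
    F_l(w).  If M were composite, its least prime factor would be below 17^r,
    against the assumption. *)

(** * Conjugates of pi over any field, and polynomial arithmetic modulo X^17 + 1 *)

(** At x = z this is pi, because zeta_17^9 = z^18 = -z. *)
Definition pif (F : fieldType) (x : F) : F := 1 + x ^+ 4 - x.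

(* The pairs (c, k) such that k sigma_c occurs in tau, with c modulo 34. *)
Definition tau_seq : seq (nat * nat) :=
  [:: (1, 1); (23, 3); (7, 5); (5, 7); (19, 9); (31, 11); (21, 13); (25, 15)]%N.

(** The norm of pi at x = z: the exponents c and 34 - c run through all sixteen units modulo 34. *)
Definition norm_pif (F : fieldType) (x : F) : F :=
  \prod_(p <- tau_seq) (pif (x ^+ p.1) * pif (x ^+ (34 - p.1))).

Definition alphaf (F : fieldType) (x : F) : F :=
  \prod_(p <- tau_seq) (pif (x ^+ p.1) / pif (x ^+ (34 - p.1))) ^+ p.2.

Definition gammaf (F : fieldType) (x : F) : F :=
  \prod_(p <- tau_seq) pif (x ^+ (34 - p.1)).

(* 78 generates the group of units modulo 103; it is chosen so that the prime
   (103, zeta_34 - 78^-3) contains pi. *)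
Definition pow78 : seq nat :=
  Eval vm_compute in traject (fun x => x * 78 %% 103)%N 1%N 102.

Definition ind78 (a : nat) : nat := index a pow78.

(** The Jacobi sum J(chi^n, chi^n) at x = w^n: the terms a = 0 and a = 1 vanish, and 104 - a
    represents 1 - a. *)
Definition jacobi103 (F : fieldType) (x : F) : F :=
  \sum_(a <- iota 2 101) x ^+ (ind78 a + ind78 (104 - a)).

(* Integer polynomials as lists of coefficients, multiplied modulo X^17 + 1. *)
Fixpoint padd (s t : seq Z) : seq Z :=
  match s, t with
  | [::], _ => t
  | _, [::] => s
  | a :: s', b :: t' => Z.add a b :: padd s' t'
  end.

Definition popp : seq Z -> seq Z := map Z.opp.

Definition pmod17 (s : seq Z) : seq Z := padd (take 17 s) (popp (drop 17 s)).

Fixpoint pmul_raw (s t : seq Z) : seq Z :=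
  if s is a :: s' then padd (map (Z.mul a) t) (Z0 :: pmul_raw s' t) else [::].

Definition pmul (s t : seq Z) : seq Z := pmod17 (pmul_raw s t).

Definition pexp (s : seq Z) (n : nat) : seq Z := iter n (pmul s) [:: Zpos 1].

Definition pmono (n : nat) : seq Z := pmod17 (ncons (n %% 34) Z0 [:: Zpos 1]).

Definition ppif (n : nat) : seq Z :=
  padd [:: Zpos 1] (padd (pmono (4 * n)) (popp (pmono n))).

Definition pjacobi (m : nat) : seq Z :=
  foldr (fun a s => padd (pmono (m * (ind78 a + ind78 (104 - a)))) s)
    [::] (iota 2 101).

Definition pprod (T : Type) (f : T -> seq Z) (r : seq T) : seq Z :=
  foldr (fun x s => pmul (f x) s) [:: Zpos 1] r.

(* The multiples of Phi_34 among the polynomials of degree at most 16. *)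
Definition alternating (s : seq Z) : bool :=
  if s is a :: s' then
    (size s' == 16%N)
    && all2 Z.eqb s' [seq if odd i then a else Z.opp a | i <- iota 0 16]
  else true.

(** Adding seventeen zeros pads a short difference, so that [alternating] sees all seventeen
    coefficients. *)
Definition peqb (s t : seq Z) : bool := alternating (padd (nseq 17 Z0) (padd s (popp t))).

(** * Evaluation at a 34-th root of unity, and the identities checked by computation *)

Section Evaluation.

Variables (F : fieldType) (w : F).

Definition intZ (a : Z) : F := (int_of_Z a)%:~R.

Definition peval (s : seq Z) : F := foldr (fun a x => intZ a + w * x) 0 s.

Lemma intZD a b : intZ (Z.add a b) = intZ a + intZ b.
Proof. by rewrite /intZ -intrD; congr (_ *~ _); lia. Qed.

Lemma intZM a b : intZ (Z.mul a b) = intZ a * intZ b.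
Proof. by rewrite /intZ -intrM; congr (_ *~ _); lia. Qed.

Lemma intZN a : intZ (Z.opp a) = - intZ a.
Proof. by rewrite /intZ -mulrNz; congr (_ *~ _); lia. Qed.

Lemma peval_padd s t : peval (padd s t) = peval s + peval t.
Proof.
elim: s t => [|a s IHs] [|b t] //=; rewrite ?add0r ?addr0 //.
by rewrite IHs intZD; ring.
Qed.

Lemma peval_popp s : peval (popp s) = - peval s.
Proof.
elim: s => [|a s IHs] /=; first by rewrite oppr0.
by rewrite -/(popp s) IHs intZN; ring.
Qed.

Lemma peval_scale a s : peval (map (Z.mul a) s) = intZ a * peval s.
Proof.
elim: s => [|b s IHs] /=; first by rewrite mulr0.
by rewrite IHs intZM; ring.
Qed.

Lemma peval_cat s t : peval (s ++ t) = peval s + w ^+ size s * peval t.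
Proof.
elim: s => [|a s IHs] /=; first by rewrite add0r mul1r.
by rewrite IHs exprS; ring.
Qed.

Lemma peval_pmul_raw s t : peval (pmul_raw s t) = peval s * peval t.
Proof.
elim: s => [|a s IHs] /=; first by rewrite mul0r.
by rewrite peval_padd peval_scale /= IHs /intZ /=; ring.
Qed.

Hypotheses (w17 : w ^+ 17 = -1) (w_neqN1 : w != -1).

Lemma w34 : w ^+ 34 = 1.
Proof. by rewrite -[34%N]/(17 * 2)%N exprM w17 sqrrN expr1n. Qed.

Lemma peval_pmod17 s : peval (pmod17 s) = peval s.
Proof.
rewrite /pmod17 peval_padd peval_popp -[in RHS](cat_take_drop 17 s) peval_cat.
have [le_s17 | lt_17s] := leqP (size s) 17.
  by rewrite drop_oversize //= oppr0 mulr0.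
by rewrite size_take lt_17s w17 mulN1r.
Qed.

Lemma peval_pmul s t : peval (pmul s t) = peval s * peval t.
Proof. by rewrite /pmul peval_pmod17 peval_pmul_raw. Qed.

Lemma peval1 : peval [:: Zpos 1] = 1.
Proof. by rewrite /= mulr0 addr0 /intZ. Qed.

Lemma peval_pexp s n : peval (pexp s n) = peval s ^+ n.
Proof.
elim: n => [|n IHn]; first exact: peval1.
by rewrite /pexp iterS -/(pexp s n) peval_pmul IHn exprS.
Qed.

Lemma peval_pmono n : peval (pmono n) = w ^+ n.
Proof.
rewrite /pmono peval_pmod17 [in RHS](divn_eq n 34) exprD mulnC exprM w34 expr1n mul1r.
elim: (n %% 34)%N => [|k IHk]; first exact: peval1.
by rewrite /= IHk exprS /intZ /= add0r.
Qed.

Lemma peval_ppif n : peval (ppif n) = pif (w ^+ n).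
Proof.
rewrite /ppif /pif peval_padd (peval_padd (pmono _)) peval_popp !peval_pmono peval1.
by rewrite -exprM mulnC addrA.
Qed.

Lemma peval_pjacobi m : peval (pjacobi m) = jacobi103 (w ^+ m).
Proof.
rewrite /pjacobi /jacobi103.
elim: (iota 2 101) => [|a s IHs]; first by rewrite big_nil.
rewrite big_cons -IHs [foldr _ _ _]/= peval_padd peval_pmono.
by rewrite exprM.
Qed.

Lemma peval_pprod (T : Type) (f : T -> seq Z) (r : seq T) :
  peval (pprod f r) = \prod_(x <- r) peval (f x).
Proof.
elim: r => [|x r IHr]; first by rewrite big_nil; apply: peval1.
by rewrite big_cons -IHr /= peval_pmul.
Qed.

(** Such a list is a multiple of Phi_34, and (w + 1) Phi_34(w) = w^17 + 1 = 0 with w + 1 nonzero. *)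
Lemma peval_alternating s : alternating s -> peval s = 0.
Proof.
case: s => [|a s] //= /andP[/eqP sz_s]; do 17?[case: s sz_s => [|? s] //= sz_s].
rewrite !andbT; do !(move=> /andP[/Z.eqb_eq->]); move=> /Z.eqb_eq->.
rewrite !intZN.
have: (w + 1) * (w ^+ 16 - w ^+ 15 + w ^+ 14 - w ^+ 13 + w ^+ 12 - w ^+ 11
   + w ^+ 10 - w ^+ 9 + w ^+ 8 - w ^+ 7 + w ^+ 6 - w ^+ 5 + w ^+ 4 - w ^+ 3
   + w ^+ 2 - w + 1) = 0.
  by rewrite -(addNr 1) -w17; ring.
move/eqP; rewrite mulf_eq0 addr_eq0 (negbTE w_neqN1) /= => /eqP Phi0.
transitivity (intZ a * 0); last by rewrite mulr0.
by rewrite -[in RHS]Phi0; ring.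
Qed.

Lemma peqbP s t : peqb s t -> peval s = peval t.
Proof.
move/peval_alternating/eqP; rewrite 2!peval_padd peval_popp.
have ->: peval (nseq 17 Z0) = 0 by rewrite /= /intZ /= !(mulr0, addr0).
by rewrite add0r subr_eq0 => /eqP.
Qed.

(** An identity in Z[X]/(Phi_34), verified by computation on coefficient lists; it therefore holds
    in every characteristic. *)
Lemma norm_pifE : norm_pif w = 103%:R.
Proof.
have ->: 103%:R = peval [:: Zpos 103] by rewrite /= mulr0 addr0 /intZ.
rewrite /norm_pif.
under eq_bigr => p _ do rewrite -!peval_ppif -peval_pmul.
rewrite -peval_pprod; apply: peqbP; by vm_compute.
Qed.

(* The parenthesis is g^34 for the Gauss sum g of the character of order 34; the
   factor w^21 was found by comparing coefficients. *)
Lemma stickelberger103 :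
  w ^+ 21 * (103%:R * jacobi103 w ^+ 17 * jacobi103 (w ^+ 2) ^+ 8
    * jacobi103 (w ^+ 4) ^+ 4 * jacobi103 (w ^+ 8) ^+ 2 * jacobi103 (w ^+ 16))
  = \prod_(p <- tau_seq)
      (pif (w ^+ p.1) ^+ p.2 * pif (w ^+ (34 - p.1)) ^+ (34 - p.2)).
Proof.
have ->: 103%:R = peval [:: Zpos 103] by rewrite /= mulr0 addr0 /intZ.
under eq_bigr => p _ do rewrite -!peval_ppif -!peval_pexp -peval_pmul.
rewrite -peval_pprod -[w in jacobi103 w]expr1 -!peval_pjacobi -!peval_pexp.
rewrite -peval_pmono -!peval_pmul; apply: peqbP; by vm_compute.
Qed.

Hypothesis F103 : 103%:R != 0 :> F.

(** Both values are factors of the norm 103, which is nonzero in [F]. *)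
Lemma pif_neq0 p : p \in tau_seq ->
  pif (w ^+ p.1) != 0 /\ pif (w ^+ (34 - p.1)) != 0.
Proof.
move=> p_tau; have := F103; rewrite -norm_pifE prodf_seq_neq0 => /allP/(_ p p_tau).
by rewrite mulf_eq0 negb_or => /andP[].
Qed.

(** Each factor b^(34 - k) is b^34 / b^k: the quotients build alpha, and the 34-th powers are
    collected in [gammaf]. *)
Lemma prod_pif_alphaf :
  \prod_(p <- tau_seq)
      (pif (w ^+ p.1) ^+ p.2 * pif (w ^+ (34 - p.1)) ^+ (34 - p.2))
  = alphaf w * gammaf w ^+ 34.
Proof.
rewrite /alphaf /gammaf -prodrXl -big_split /=.
apply: eq_big_seq => p p_tau; have [_ nz] := pif_neq0 p_tau.
have le_p34 : (p.2 <= 34)%N by move: p p_tau {nz}; apply/allP.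
set a := pif _; set b := pif _.
have ->: b ^+ 34 = b ^+ p.2 * b ^+ (34 - p.2) by rewrite -exprD subnKC.
by rewrite expr_div_n -mulrA mulKf // expf_neq0.
Qed.

End Evaluation.

(** * Gauss and Jacobi sums modulo 103 with values in a field *)

Section GaussSums.

Variables (K : fieldType) (om : K).
Hypothesis om103 : 103.-primitive_root om.

Definition psi (a : 'F_103) : K := om ^+ a.

Lemma psi_nat m : psi m%:R = om ^+ m.
Proof. by rewrite /psi /= val_Fp_nat // prim_expr_mod. Qed.

Lemma psiD a b : psi (a + b) = psi a * psi b.
Proof. by rewrite -[a]natr_Zp -[b]natr_Zp -natrD !psi_nat exprD. Qed.

Lemma sum_psi t : \sum_b psi (b * t) = if t == 0 then 103%:R else 0.
Proof.
case: eqP => [->|/eqP nz_t].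
  under eq_bigr do rewrite mulr0 -[0]/(0%:R) psi_nat expr0.
  by rewrite sumr_const card_Fp.
have psi1 : psi 1 != 1.
  by rewrite -[1]/(1%:R) psi_nat -(prim_order_dvd om103).
set S := \sum_b _; have: (psi 1 - 1) * S = 0.
  rewrite mulrBl mul1r {1}/S mulr_sumr.
  under eq_bigr do rewrite -psiD -[1](mulVf nz_t) -mulrDl.
  by rewrite [X in _ - X](reindex_inj (@addrI _ t^-1)) /= subrr.
by move/eqP; rewrite mulf_eq0 subr_eq0 (negbTE psi1) => /eqP.
Qed.

Definition gauss (f : 'F_103 -> K) : K := \sum_a f a * psi a.

Definition jacobi (f : 'F_103 -> K) : K := \sum_a f a * f (1 - a).

Definition character (f : 'F_103 -> K) : Prop :=
  [/\ f 0 = 0, f 1 = 1 & {morph f : a b / a * b}].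

Lemma sum_character f u : character f -> u != 0 -> f u != 1 -> \sum_a f a = 0.
Proof.
move=> [_ _ fM] nz_u fu1; set S := \sum_a _.
have: (f u - 1) * S = 0.
  rewrite mulrBl mul1r {1}/S mulr_sumr.
  under eq_bigr do rewrite -fM.
  by rewrite [X in _ - X](reindex_inj (mulfI nz_u)) /= subrr.
by move/eqP; rewrite mulf_eq0 subr_eq0 (negbTE fu1) => /eqP.
Qed.

Lemma characterX f n : (0 < n)%N -> character f -> character (fun a => f a ^+ n).
Proof.
move=> n_gt0 [f0 f1 fM]; split=> [||a b]; rewrite ?f0 ?f1 ?expr1n //.
  by rewrite expr0n gtn_eqF.
by rewrite fM exprMn.
Qed.

Lemma characterN1 f : character f -> f (-1) ^+ 2 = 1.
Proof.
move=> [_ f1 fM]; rewrite expr2 -fM -f1; congr (f _).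
by rewrite mulrNN mulr1.
Qed.

(** Pairs of arguments are grouped by their sum c; for c != 0 the substitution a -> c a brings out
    f(c)^2 and the Jacobi sum. *)
Lemma gauss_sqr f : character f -> \sum_a f a ^+ 2 = 0 ->
  gauss f ^+ 2 = jacobi f * gauss (fun a => f a ^+ 2).
Proof.
move=> [f0 f1 fM] sum0.
rewrite expr2 /gauss mulr_suml.
transitivity (\sum_a \sum_c f a * f (c - a) * psi c).
  apply: eq_bigr => a _; rewrite mulr_sumr (reindex_inj (@addIr _ (- a))) /=.
  apply: eq_bigr => c _; rewrite mulrACA -psiD; congr (_ * psi _); ring.
rewrite exchange_big mulr_sumr /=; apply: eq_bigr => c _.
rewrite -mulr_suml mulrA; congr (_ * _).
(* At c = 0 the inner sum is f(-1) times the sum of f^2, which is zero by hypothesis. *)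
have [-> | nz_c] := eqVneq c 0.
  rewrite f0 expr0n mulr0.
  under eq_bigr do rewrite sub0r -mulN1r fM mulrCA -expr2.
  by rewrite -mulr_sumr sum0 mulr0.
rewrite (reindex_inj (mulfI nz_c)) /= mulr_suml; apply: eq_bigr => a _.
have ->: c - c * a = c * (1 - a) by ring.
by rewrite !fM; ring.
Qed.

Lemma gauss_mul_inv f g : character f -> character g -> \sum_a f a = 0 ->
  (forall a, a != 0 -> f a * g a = 1) -> gauss f * gauss g = 103%:R * f (-1).
Proof.
move=> [f0 f1 fM] [g0 g1 gM] sum0 fg1; rewrite mulrC /gauss mulr_suml.
transitivity (\sum_(b | b != 0) \sum_c f c * psi (b * (c + 1))).
  rewrite (bigD1 0) //= g0 !mul0r add0r; apply: eq_bigr => b nz_b.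
  rewrite mulr_sumr (reindex_inj (mulfI nz_b)) /=; apply: eq_bigr => c _.
  rewrite fM mulrDr mulr1 addrC psiD.
  by rewrite -[f c in RHS]mul1r -(fg1 b) //; ring.
rewrite exchange_big /=.
(* Orthogonality over all b gives 103 at c = -1 and 0 elsewhere; leaving out b = 0 subtracts psi(0)
   = 1. *)
transitivity (\sum_c (f c * (if c == -1 then 103%:R else 0) - f c)).
  apply: eq_bigr => c _; rewrite -mulr_sumr -[c == -1]subr_eq0 opprK -sum_psi.
  by rewrite [in RHS](bigD1 0) //= mul0r -[psi 0]/(om ^+ 0) expr0; ring.
rewrite sumrB sum0 subr0 (bigD1 (-1)) //= ?eqxx big1 ?addr0 1?mulrC //.
by move=> c /negbTE->; rewrite mulr0.
Qed.

(** The Frobenius fixes the values of f and turns psi(a) into psi(p a); the substitution a -> p a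
    then brings out f(p). *)
Lemma gauss_frobenius f p : p \in [pchar K] -> character f ->
    (p%:R : 'F_103) != 0 -> (forall a, f a ^+ p = f a) ->
  f p%:R * gauss f ^+ p = gauss f.
Proof.
move=> pcharKp [_ _ fM] nz_p fXp.
rewrite -(pFrobenius_autE pcharKp) rmorph_sum mulr_sumr /=.
rewrite [RHS](reindex_inj (mulfI nz_p)) /=; apply: eq_bigr => a _.
rewrite pFrobenius_autE exprMn fXp fM mulrA; congr (_ * _).
by rewrite -[a in RHS]natr_Zp -natrM psi_nat mulnC exprM.
Qed.

End GaussSums.

(** * Primitive 34-th roots of unity *)

Lemma prim34_exp17 (K : fieldType) (w : K) :
  34.-primitive_root w -> w ^+ 17 = -1.
Proof.
move=> w34; have /eqP: (w ^+ 17) ^+ 2 = 1 by rewrite -exprM prim_expr_order.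
by rewrite sqrf_eq1 -(prim_order_dvd w34) => /eqP.
Qed.

Lemma prim34_neqN1 (K : fieldType) (w : K) : 34.-primitive_root w -> w != -1.
Proof.
move=> w34; apply/negP=> /eqP wN1; have := prim_order_dvd w34 2.
by rewrite wN1 sqrrN expr1n eqxx.
Qed.

Lemma exp17_prim34 (K : fieldType) (w : K) :
  2%:R != 0 :> K -> w ^+ 17 = -1 -> w != -1 -> 34.-primitive_root w.
Proof.
move=> nz2 w17 wN1.
have [m w_m m_dvd] := prim_order_exists (isT : (0 < 34)%N) (w34 w17).
have N1 : -1 != 1 :> K by rewrite eq_sym -addr_eq0.
have m_ndvd k : w ^+ k != 1 -> ~~ (m %| k)%N by rewrite (prim_order_dvd w_m).
have m17 : ~~ (m %| 17)%N by apply: m_ndvd; rewrite w17.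
have m2 : ~~ (m %| 2)%N.
  apply: m_ndvd; apply: contra wN1 => /eqP w2.
  by rewrite -w17 -[17%N]/(2 * 8).+1 exprSr exprM w2 expr1n mul1r.
have: m \in divisors 34 by rewrite -dvdn_divisors.
rewrite (_ : divisors 34 = [:: 1; 2; 17; 34]%N) // !inE.
by case/or4P=> /eqP m_eq; move: w_m m17 m2; rewrite m_eq.
Qed.

(** * The character of order 34 modulo 103 and the 34-th power of its Gauss sum *)

Section ResidueCharacter.

Variables (K : fieldType) (w : K).
Hypothesis prim_w : 34.-primitive_root w.

Let w17 : w ^+ 17 = -1 := prim34_exp17 prim_w.

Definition chi (a : 'F_103) : K := if a == 0 then 0 else w ^+ ind78 a.

Lemma Fp_iter_mul p g i : prime p ->
  (iter i (fun x => x * g %% p) 1)%N%:R = g%:R ^+ i :> 'F_p.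
Proof.
move=> p_pr; elim: i => [|i IHi]; first by rewrite expr0.
by rewrite iterS Fp_nat_mod // natrM IHi exprSr.
Qed.

(** Multiplication by 78 raises the index by one modulo 102, hence modulo 34; this is checked on all
    nonzero residues. *)
Lemma chi_gen b : chi (78%:R * b) = w * chi b.
Proof.
rewrite /chi mulf_eq0 -[78%:R == 0]/false /=.
case: eqP => [_|/eqP nz_b]; first by rewrite mulr0.
rewrite -exprS -(expr_mod _ (w34 w17)) -[in RHS](expr_mod _ (w34 w17)).
have lt_b : (b < 103)%N by rewrite -[103%N]/(Zp_trunc (pdiv 103)).+2.
have b_gt0 : (0 < b)%N by rewrite lt0n.
have e: (78%:R * b : 'F_103) = (78 * b %% 103)%N :> nat.
  by rewrite -{1}[b]natr_Zp -natrM val_Fp_nat.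
congr (_ ^+ _); transitivity (ind78 (78 * b %% 103) %% 34)%N.
  by congr (ind78 _ %% _)%N.
have := allP (_ :
  all (fun a => ind78 (78 * a %% 103) %% 34 == (ind78 a).+1 %% 34)%N (iota 1 102)).
move=> /(_ _ b) H; apply/eqP/H; first by vm_compute.
by rewrite mem_iota b_gt0.
Qed.

Lemma Fp103_gen (a : 'F_103) : a != 0 -> a = 78%:R ^+ ind78 a.
Proof.
move=> nz_a.
have lt_a : (a < 103)%N by rewrite -[103%N]/(Zp_trunc (pdiv 103)).+2.
have a_in : (a : nat) \in pow78.
  have := allP (_ : all (mem pow78) (iota 1 102)) => /(_ _ a); apply.
    by vm_compute.
  by rewrite mem_iota lt0n nz_a.
have def_pow : pow78 = traject (fun x => x * 78 %% 103)%N 1%N 102 by vm_compute.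
have ind_lt : (ind78 a < 102)%N by rewrite /ind78 -[102%N]/(size pow78) index_mem.
rewrite -(@Fp_iter_mul 103 78 _ isT) -(nth_traject _ ind_lt) -def_pow.
by rewrite (nth_index 1%N a_in) natr_Zp.
Qed.

Lemma chi_character : character chi.
Proof.
have chiX i b : chi (78%:R ^+ i * b) = w ^+ i * chi b.
  elim: i => [|i IHi]; first by rewrite !mul1r.
  by rewrite exprS -mulrA chi_gen IHi exprS mulrA.
split=> // a b.
have [-> | nz_a] := eqVneq a 0; first by rewrite mul0r /chi eqxx mul0r.
have chia : chi a = w ^+ ind78 a by rewrite /chi (negbTE nz_a).
by rewrite chia {1}(Fp103_gen nz_a) chiX.
Qed.

Lemma jacobi_chi n : (0 < n)%N -> jacobi (fun a => chi a ^+ n) = jacobi103 (w ^+ n).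
Proof.
move=> n_gt0; have zX : 0 ^+ n = 0 :> K by rewrite expr0n gtn_eqF.
rewrite /jacobi /jacobi103.
pose c (a : nat) : K := chi a%:R ^+ n * chi (1 - a%:R) ^+ n.
transitivity (\sum_(0 <= a < 103) c a).
  by rewrite big_mkord; apply: eq_bigr => a _; rewrite /c natr_Zp.
rewrite big_ltn // big_ltn //.
rewrite {1}/c {1}/chi eqxx zX mul0r add0r.
rewrite {1}/c subrr {2}/chi eqxx zX mulr0 add0r.
rewrite -/(index_iota 2 103); apply: eq_big_nat => a /andP[a_ge2 a_lt].
have e104 : 1 - a%:R = (104 - a)%:R :> 'F_103.
  rewrite natrB; last exact: leq_trans (ltnW a_lt) _.
  by congr (_ - _); apply/val_inj.
have chin m : (0 < m < 103)%N -> chi m%:R = w ^+ ind78 m.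
  case/andP=> m_gt0 m_lt; rewrite /chi -val_eqE /= val_Fp_nat // modn_small //.
  by rewrite gtn_eqF.
rewrite /c e104 (chin a) ?(chin (104 - a)%N) //; try lia.
by rewrite -exprMn -exprD exprAC.
Qed.

(** For the Gauss sum g of [chi], the Frobenius gives chi(M) g^(M-1) = 1, and M - 1 = 34 * 34^(s+1).
    As w^21 g^34 is alpha times [gammaf w ^+ 34], it remains to see that w^21 and this 34-th power
    become 1 when raised to 34^(s+1). *)
Lemma alphaf_pow_chi (om : K) (M s : nat) : 103.-primitive_root om ->
    prime M -> M \in [pchar K] -> (M = 34 * 34 ^ s.+1 + 1)%N -> ~~ (103 %| M)%N ->
  w ^+ ind78 (M %% 103) * alphaf w ^+ (34 ^ s.+1) = 1.
Proof.
move=> om103 M_pr pcharM def_M M103.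
have w34 := prim_expr_order prim_w.
have wN1 := prim34_neqN1 prim_w.
have chiC := chi_character.
have chiXC n : (0 < n)%N -> character (fun a => chi a ^+ n).
  by move=> n_gt0; apply: characterX.
have chi78 : chi 78%:R = w by [].
have chi34 a : a != 0 -> chi a ^+ 34 = 1.
  by rewrite /chi => /negbTE->; rewrite exprAC w34 expr1n.
have chiXM a : chi a ^+ M = chi a.
  have [-> | /chi34 a34] := eqVneq a 0.
    by rewrite [chi 0]/(0 : K) expr0n gtn_eqF ?prime_gt0.
  by rewrite def_M exprD exprM a34 expr1n mul1r.
have sum0 n : ~~ (34 %| n)%N -> \sum_a chi a ^+ n = 0.
  move=> n34; have n_gt0 : (0 < n)%N by case: n n34.
  have nz78 : (78%:R : 'F_103) != 0 by [].
  have := sum_character (chiXC n n_gt0) nz78; apply.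
  by rewrite chi78 -(prim_order_dvd prim_w).
pose G n := gauss om (fun a => chi a ^+ n).
have Gsqr n : (0 < n)%N -> ~~ (34 %| n * 2)%N ->
    G n ^+ 2 = jacobi103 (w ^+ n) * G (n * 2)%N.
  move=> n_gt0 n34; have sum0n : \sum_a (chi a ^+ n) ^+ 2 = 0.
    by under eq_bigr do rewrite -exprM; apply: sum0.
  rewrite /G (gauss_sqr om103 (chiXC n n_gt0) sum0n) (jacobi_chi n_gt0).
  by congr (_ * _); apply: eq_bigr => a _; rewrite -exprM.
(* On units chi^32 is the inverse of chi^2, and chi(-1)^32 = 1 because chi(-1)^2 = 1. *)
have G32 : G 32%N * G 2%N = 103%:R.
  have inv34 a : a != 0 -> chi a ^+ 32 * chi a ^+ 2 = 1.
    by move=> nz_a; rewrite -exprD; apply: chi34.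
  rewrite /G (gauss_mul_inv om103 (chiXC 32%N isT) (chiXC 2%N isT) (sum0 32%N isT) inv34).
  have exp32 (x : K) : x ^+ 2 = 1 -> x ^+ 32 = 1.
    by move=> x2; rewrite (exprM x 2 16) x2 expr1n.
  by rewrite (exp32 _ (characterN1 chiC)) mulr1.
(* Squaring leads from chi^n to chi^(2n) along 1, 2, 4, 8, 16, 32, each time with a Jacobi sum; the
   remaining product of the sums for 32 and 2 is 103. *)
have G34 : G 1%N ^+ 34 = 103%:R * jacobi103 w ^+ 17 * jacobi103 (w ^+ 2) ^+ 8
    * jacobi103 (w ^+ 4) ^+ 4 * jacobi103 (w ^+ 8) ^+ 2 * jacobi103 (w ^+ 16).
  have tower (g1 g2 g4 g8 g16 g32 j1 j2 j4 j8 j16 : K) :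
      g1 ^+ 2 = j1 * g2 -> g2 ^+ 2 = j2 * g4 -> g4 ^+ 2 = j4 * g8 ->
      g8 ^+ 2 = j8 * g16 -> g16 ^+ 2 = j16 * g32 ->
      g1 ^+ 34 = g32 * g2 * j1 ^+ 17 * j2 ^+ 8 * j4 ^+ 4 * j8 ^+ 2 * j16.
    move=> E1 E2 E4 E8 E16; rewrite (exprM _ 2 17) E1 exprMn (exprS g2 16).
    rewrite (exprM g2 2 8) E2 exprMn (exprM g4 2 4) E4 exprMn.
    by rewrite (exprM g8 2 2) E8 exprMn E16; ring.
  rewrite -G32; apply: (tower _ _ (G 4%N) (G 8%N) (G 16%N)).
  - exact: Gsqr 1%N isT isT.
  - exact: Gsqr 2%N isT isT.
  - exact: Gsqr 4%N isT isT.
  - exact: Gsqr 8%N isT isT.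
  - exact: Gsqr 16%N isT isT.
have K103 : 103%:R != 0 :> K.
  rewrite -(dvdn_pcharf pcharM) (dvdn_prime2 M_pr (isT : prime 103)).
  by apply: contra M103 => /eqP ->; apply: dvdnn.
have G34E : w ^+ 21 * G 1%N ^+ 34 = alphaf w * gammaf w ^+ 34.
  by rewrite G34 (stickelberger103 w17 wN1) prod_pif_alphaf.
have nz_alpha : alphaf w != 0.
  rewrite /alphaf prodf_seq_neq0; apply/allP => p p_tau.
  have [nz1 nz2] := pif_neq0 w17 wN1 K103 p_tau.
  by rewrite expf_neq0 ?mulf_neq0 ?invr_eq0.
have nz_gamma : gammaf w != 0.
  rewrite /gammaf prodf_seq_neq0; apply/allP => p p_tau.
  by have [_ nz2] := pif_neq0 w17 wN1 K103 p_tau.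
have nzG : G 1%N != 0.
  apply/eqP=> G0; have /eqP := G34E.
  rewrite G0 expr0n /= mulr0 eq_sym mulf_eq0 (negbTE nz_alpha) expf_eq0 /=.
  by rewrite (negbTE nz_gamma).
have nzM : (M%:R : 'F_103) != 0.
  by rewrite -(dvdn_pcharf (pchar_Fp _)).
have := gauss_frobenius om103 pcharM chiC nzM chiXM.
have ->: gauss om chi = G 1%N by [].
rewrite def_M exprD expr1 -def_M mulrA => /eqP.
rewrite -[X in _ == X]mul1r (inj_eq (mulIf nzG)) exprM => /eqP chiG.
(* M is 1 modulo 34, so the Frobenius fixes w and hence [gammaf w]. *)
have gamma1 : gammaf w ^+ (34 * 34 ^ s.+1) = 1.
  apply: (mulIf nz_gamma); rewrite -exprSr -addn1 -def_M mul1r.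
  rewrite -(pFrobenius_autE pcharM) /gammaf rmorph_prod /=.
  apply: eq_bigr => p _; rewrite /pif rmorphB rmorphD rmorph1 !rmorphXn /=.
  suff ->: pFrobenius_aut pcharM w = w by [].
  by rewrite pFrobenius_autE def_M exprD exprM w34 expr1n mul1r.
have alphaE : alphaf w ^+ (34 ^ s.+1) = G 1%N ^+ 34 ^+ (34 ^ s.+1).
  rewrite -[LHS]mulr1 -gamma1 exprM -exprMn -G34E exprMn expnS.
  by rewrite [w ^+ 21 ^+ _]exprAC [w ^+ _]exprM w34 !expr1n mul1r.
rewrite alphaE -[RHS]chiG; congr (_ * _); rewrite /chi (negbTE nzM).
by rewrite (val_Fp_nat (isT : prime 103)).
Qed.

End ResidueCharacter.

(** * Symmetric functions of u + u^-1 for u of order 17 or 34 *)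

Section ElementarySymmetric.

Variable F : fieldType.

Lemma mevalmesymE n (v : 'I_n -> F) (k : nat) :
  meval v (mesym n F k)
  = \sum_(h : {set 'I_n} | #|h| == k) \prod_(i in h) v i.
Proof.
rewrite /mesym rmorph_sum; apply: eq_bigr => h _ /=.
by rewrite rmorph_prod; apply: eq_bigr => i _ /=; rewrite mevalXU.
Qed.

Lemma coef_prod_XsubC n (v : 'I_n -> F) (k : nat) : (k <= n)%N ->
  (\prod_(i < n) ('X - (v i)%:P))`_(n - k)
  = (-1) ^+ k * meval v (mesym n F k).
Proof.
move=> le_kn; have := mroots_coeff [tuple v i | i < n] (Ordinal (le_kn : (k < n.+1)%N)).
rewrite big_tuple /= => eq_coef.
transitivity ((\prod_(i < n) ('X - (tnth [tuple v i | i < n] i)%:P))`_(n - k)).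
  by congr (polyseq _)`__; apply: eq_bigr => i _; rewrite tnth_mktuple.
rewrite eq_coef !mevalmesymE; congr (_ * _); apply: eq_bigr => h _.
by apply: eq_bigr => i _; rewrite tnth_mktuple.
Qed.

(* For e = 1 (resp. e = -1), the minimal polynomial of u + u^-1 where u is a
   primitive root of unity of order 17 (resp. 34). *)
Definition minpoly17 (e : F) : {poly F} :=
  Poly [:: 1; -4 * e; -10; 10 * e; 15; -6 * e; -7; e; 1].

(** The coefficients of [minpoly17 e] up to alternating sign; e = 1 gives the values of case (i), e
    = -1 those of case (ii). *)
Definition esym17 (e : F) (k : nat) : F :=
  [:: 1; - e; -7; 6 * e; 15; -10 * e; -10; 4 * e; 1]`_k.

Lemma size_minpoly17 e : size (minpoly17 e) = 9%N.
Proof. by rewrite (@PolyK _ 0) //= oner_neq0. Qed.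

Lemma coef_minpoly17 e k : (k <= 8)%N ->
  (minpoly17 e)`_(8 - k) = (-1) ^+ k * esym17 e k.
Proof.
rewrite /minpoly17 /esym17 coef_Poly.
by do 9?[case: k => [|k] //=] => _; ring.
Qed.

(** As e^2 = 1, the quotient (u^17 - e) / (u - e) is palindromic of degree 16, so u^-8 times it is a
    polynomial in u + u^-1. *)
Lemma minpoly17P e u : e = 1 \/ e = -1 -> u != 0 ->
  (u - e) * (u ^+ 8 * (minpoly17 e).[u + u^-1]) = u ^+ 17 - e.
Proof.
move=> e1 nz_u; rewrite horner_Poly /=.
by case: e1 => ->; field.
Qed.

Lemma minpoly17_eq e (v : 'I_8 -> F) :
  minpoly17 e = \prod_(i < 8) ('X - (v i)%:P) <->
  (forall j, (1 <= j <= 8)%N -> meval v (mesym 8 F j) = esym17 e j).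
Proof.
split=> [eq_p j /andP[_ j8] | eq_e].
  apply: (mulfI (_ : (-1) ^+ j != 0)); first by rewrite signr_eq0.
  by rewrite -coef_prod_XsubC // -eq_p coef_minpoly17.
apply/polyP=> i; have [i8 | i8] := leqP i 8; last first.
  rewrite !nth_default ?size_minpoly17 // size_prod_XsubC.
  by rewrite /index_enum -enumT size_enum_ord.
have [k k8 ->]: exists2 k, (k <= 8)%N & i = (8 - k)%N by exists (8 - i)%N; lia.
rewrite coef_minpoly17 // coef_prod_XsubC //; congr (_ * _).
have [-> | k0] := posnP k; last by rewrite eq_e // k0.
rewrite mevalmesymE (eq_bigl (pred1 set0)) => [|h]; last exact: cards_eq0.
by rewrite big_pred1_eq big_set0.
Qed.

(** A + A^-1 is a root of [minpoly17 e], so A^17 = e. If A^2 were 1, then A = e would follow, but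
    the value of [minpoly17 e] at 2e is 17. *)
Lemma esym17_root e (A : F) (v : 'I_8 -> F) : e = 1 \/ e = -1 -> A != 0 ->
    2%:R != 0 :> F -> 17%:R != 0 :> F -> v ord0 = A + A^-1 ->
    (forall j, (1 <= j <= 8)%N -> meval v (mesym 8 F j) = esym17 e j) ->
  A ^+ 34 = 1 /\ A ^+ 2 != 1.
Proof.
move=> e1 nzA nz2 nz17 v0 /minpoly17_eq eq_p.
have rootA : (minpoly17 e).[A + A^-1] = 0.
  by rewrite eq_p horner_prod (bigD1 ord0) //= hornerXsubC v0 subrr mul0r.
have A17 : A ^+ 17 = e.
  by apply/eqP; rewrite -subr_eq0 -(minpoly17P e1 nzA) rootA !mulr0.
split; first by rewrite (exprM A 17 2) A17; case: e1 => ->; rewrite ?sqrrN expr1n.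
apply: contraNneq nz17 => A2.
have defA : A = e by rewrite -A17 exprS (exprM A 2 8) A2 expr1n mulr1.
rewrite -rootA defA horner_Poly /=.
by case: e1 => ->; apply/eqP; rewrite ?invrN ?invr1; ring.
Qed.

(** The eight sums are distinct roots of a monic polynomial of degree 8, which is therefore the
    product of the linear factors. *)
Lemma prim17_esym e (u : F) : e = 1 \/ e = -1 -> 17.-primitive_root (e * u) ->
  forall j, (1 <= j <= 8)%N ->
  meval (fun i : 'I_8 => u ^+ (2 * i + 1) + (u ^+ (2 * i + 1))^-1)
    (mesym 8 F j) = esym17 e j.
Proof.
move=> e1 prim_eu; apply/minpoly17_eq.
pose v (i : 'I_8) := u ^+ (2 * i + 1) + (u ^+ (2 * i + 1))^-1.
rewrite -/v.
have ee : e * e = 1 by case: e1 => ->; rewrite ?mulrNN mulr1.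
have eX i : e ^+ (2 * i + 1) = e by rewrite exprD exprM expr2 ee expr1n mul1r.
have nz_e : e != 0 by apply: contra_eq_neq ee => ->; rewrite mul0r eq_sym oner_neq0.
have nz_u : u != 0.
  apply: contra_eq_neq (prim_expr_order prim_eu) => ->.
  by rewrite mulr0 expr0n eq_sym oner_neq0.
pose t := e * u; pose T i := t ^+ (2 * i + 1).
have uE i : u ^+ (2 * i + 1) = e * T i.
  by rewrite /T exprMn eX mulrA ee mul1r.
have nzT i : T i != 0 by rewrite expf_neq0 ?mulf_neq0.
have T1 (i : 'I_8) : T i != 1.
  by rewrite -(prim_order_dvd prim_eu); have := ltn_ord i; lia.
have root_v i : (minpoly17 e).[v i] = 0.
  have nzU : u ^+ (2 * i + 1) != 0 by rewrite expf_neq0.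
  have := minpoly17P e1 nzU; rewrite [_ ^+ 17]exprAC.
  have ->: u ^+ 17 = e.
    apply: (mulfI nz_e); rewrite ee -[RHS](prim_expr_order prim_eu) exprMn.
    by congr (_ * _); rewrite (eX 8%N).
  rewrite eX subrr => /eqP; rewrite mulf_eq0 subr_eq0 uE.
  rewrite -[X in _ == X]mulr1 (inj_eq (mulfI nz_e)) (negbTE (T1 i)) /= -uE.
  by rewrite mulf_eq0 (negbTE (expf_neq0 8 nzU)) => /eqP.
(* Equal sums force T i = T j or T i * T j = 1; the latter would make 17 divide an even number
   between 2 and 30. *)
have v_inj : injective v.
  move=> i j; rewrite /v !uE !invfM => eq_v.
  have: (T i - T j) * (T i * T j - 1) = 0.
    have eV : e^-1 = e by apply: (mulfI nz_e); rewrite ee divff.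
    have {eq_v} : T i + (T i)^-1 = T j + (T j)^-1.
      by apply: (mulfI nz_e); rewrite !mulrDr -{2 4}eV.
    move/(congr1 (fun x => x * (T i * T j))) => eq_v.
    transitivity ((T i + (T i)^-1) * (T i * T j) - (T j + (T j)^-1) * (T i * T j)).
      by field; rewrite !nzT.
    by rewrite eq_v subrr.
  move/eqP; rewrite mulf_eq0 !subr_eq0 /T -exprD -(prim_order_dvd prim_eu).
  rewrite (eq_prim_root_expr prim_eu) => /orP[/eqP eq_ij | dvd_ij]; apply/val_inj => /=;
  by have := ltn_ord i; have := ltn_ord j; lia.
have := @all_roots_prod_XsubC _ (minpoly17 e) [seq v i | i <- enum 'I_8].
rewrite size_minpoly17 size_map size_enum_ord big_map big_enum /=.
have ->: lead_coef (minpoly17 e) = 1.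
  by rewrite lead_coefE size_minpoly17 (coef_minpoly17 e (isT : (0 <= 8)%N)) mul1r.
rewrite scale1r; apply=> //.
- by apply/allP=> _ /mapP[i _ ->]; apply/rootP.
- by rewrite uniq_rootsE map_inj_uniq ?enum_uniq.
Qed.

End ElementarySymmetric.

(** * Finite fields with prescribed roots of unity *)

(** By Euler's theorem N divides l^phi(N) - 1, the order of the cyclic group of units of the field
    with l^phi(N) elements. *)
Lemma finField_prim_root (l N : nat) : prime l -> (0 < N)%N -> coprime N l ->
  exists K : finFieldType, l \in [pchar K] /\ exists w : K, N.-primitive_root w.
Proof.
move=> l_pr N_gt0 coNl.
have k_gt0 : (0 < totient N)%N by rewrite totient_gt0.
have [K pcharK cardK] := pPrimePowerField l_pr k_gt0.
exists K; split=> //.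
pose m := #|K|.-1; have m_gt0 : (0 < m)%N.
  by rewrite /m -subn1 subn_gt0 finNzRing_gt1.
pose rs := [seq x <- enum K | x != 0].
have dvdNm : (N %| m)%N.
  rewrite /m cardK -subn1 -eqn_mod_dvd ?expn_gt0 ?prime_gt0 //.
  by apply/eqP/Euler_exp_totient; rewrite coprime_sym.
have rs_root : all m.-unity_root rs.
  apply/allP=> x; rewrite mem_filter => /andP[nz_x _]; rewrite unity_rootE.
  apply/eqP; apply: (mulIf nz_x).
  by rewrite mul1r -exprSr prednK ?expf_card // ltnW ?finNzRing_gt1.
have sz_rs : (m <= size rs)%N.
  rewrite size_filter -(leq_add2l (count (pred1 0) (enum K))) count_predC.
  rewrite count_uniq_mem ?enum_uniq // mem_enum -cardE add1n prednK //.
  by rewrite ltnW ?finNzRing_gt1.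
have /hasP[w _ prim_w] := has_prim_root m_gt0 rs_root (filter_uniq _ (enum_uniq K)) sz_rs.
by exists (w ^+ (m %/ N)); apply: dvdn_prim_root.
Qed.

(** * Reduction from z to w, as a relation between two fields *)

Section Reduction.

Variables (F K : fieldType) (z : F) (w : K).

Definition evalz (R : fieldType) (x : R) (P : {poly int}) : R :=
  horner_eval x (map_poly intr P).

Lemma evalzD (R : fieldType) (x : R) P Q : evalz x (P + Q) = evalz x P + evalz x Q.
Proof. by rewrite /evalz !rmorphD. Qed.

Lemma evalzM (R : fieldType) (x : R) P Q : evalz x (P * Q) = evalz x P * evalz x Q.
Proof. by rewrite /evalz !rmorphM. Qed.

Lemma evalzXn (R : fieldType) (x : R) P n : evalz x (P ^+ n) = evalz x P ^+ n.
Proof. by rewrite /evalz !rmorphXn. Qed.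

Lemma evalz_int (R : fieldType) (x : R) (a : int) : evalz x a%:~R = a%:~R.
Proof. by rewrite /evalz !rmorph_int. Qed.

Lemma evalzX (R : fieldType) (x : R) : evalz x 'X = x.
Proof. by rewrite /evalz map_polyX /horner_eval hornerX. Qed.

(* x in Z[1/103][z] reduces to y under z |-> w. *)
Definition reduces (x : F) (y : K) : Prop :=
  exists d (P : {poly int}),
    103%:~R ^+ d * x = evalz z P /\ 103%:~R ^+ d * y = evalz w P.

Lemma reduces_int (a : int) : reduces a%:~R a%:~R.
Proof. by exists 0%N, a%:~R; rewrite !mul1r !evalz_int. Qed.

Lemma reduces_gen : reduces z w.
Proof. by exists 0%N, 'X; rewrite !mul1r !evalzX. Qed.

Lemma reducesD x y x' y' : reduces x x' -> reduces y y' -> reduces (x + y) (x' + y').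
Proof.
move=> [d [P [Px Px']]] [e [Q [Qy Qy']]].
exists (d + e)%N, (103%:~R ^+ e * P + 103%:~R ^+ d * Q).
rewrite !evalzD !evalzM !evalzXn !evalz_int -Px -Px' -Qy -Qy' !exprD.
by split; ring.
Qed.

Lemma reducesM x y x' y' : reduces x x' -> reduces y y' -> reduces (x * y) (x' * y').
Proof.
move=> [d [P [Px Px']]] [e [Q [Qy Qy']]].
exists (d + e)%N, (P * Q); rewrite !evalzM -Px -Px' -Qy -Qy' !exprD.
by split; ring.
Qed.

Lemma reducesN x x' : reduces x x' -> reduces (- x) (- x').
Proof.
by move/(reducesM (reduces_int (-1))); rewrite mulN1r mulN1r.
Qed.

Lemma reducesX x x' n : reduces x x' -> reduces (x ^+ n) (x' ^+ n).
Proof.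
move=> xx'; elim: n => [|n IHn]; first exact: reduces_int 1.
by rewrite !exprS; apply: reducesM.
Qed.

Lemma reduces_sum (I : Type) (r : seq I) (P : pred I) (f : I -> F) (g : I -> K) :
    (forall i, P i -> reduces (f i) (g i)) ->
  reduces (\sum_(i <- r | P i) f i) (\sum_(i <- r | P i) g i).
Proof.
move=> fg; elim/big_rec2: _ => [|i y x Pi xy]; first exact: reduces_int 0.
by apply: reducesD; first exact: fg.
Qed.

Lemma reduces_prod (I : eqType) (r : seq I) (P : pred I) (f : I -> F) (g : I -> K) :
    (forall i, i \in r -> P i -> reduces (f i) (g i)) ->
  reduces (\prod_(i <- r | P i) f i) (\prod_(i <- r | P i) g i).
Proof.
move=> fg; rewrite big_seq_cond [in X in reduces _ X]big_seq_cond.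
elim/big_rec2: _ => [|i y x /andP[ri Pi] xy]; first exact: reduces_int 1.
by apply: reducesM => //; apply: fg.
Qed.

Hypotheses (F103 : 103%:R != 0 :> F) (K103 : 103%:R != 0 :> K).

(** If x y = 103 then x^-1 = y / 103, which costs one more power of 103. *)
Lemma reduces_inv x x' y y' : reduces y y' ->
  x * y = 103%:R -> x' * y' = 103%:R -> reduces x^-1 x'^-1.
Proof.
move=> [d [P [Py Py']]] xy xy'; exists d.+1, P; rewrite -Py -Py'.
have nzx : x != 0 by apply: contraNneq F103 => x0; rewrite -xy x0 mul0r.
have nzx' : x' != 0 by apply: contraNneq K103 => x0; rewrite -xy' x0 mul0r.
by rewrite !exprS -[103%:~R]/103%:R -[103%:~R]/103%:R -{1}xy -{1}xy'; split; field.
Qed.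

Lemma reduces_pif x x' : reduces x x' -> reduces (pif x) (pif x').
Proof.
move=> xx'; apply: reducesD; last exact: reducesN.
by apply: reducesD; [apply: reduces_int 1 | apply: reducesX].
Qed.

Variables (x : F) (x' : K).
Hypotheses (xx' : reduces x x') (x17 : x ^+ 17 = -1) (xN1 : x != -1).
Hypotheses (x17' : x' ^+ 17 = -1) (xN1' : x' != -1).

(** The cofactor of this conjugate in the norm 103 is the product of all the others. *)
Lemma reduces_pif_inv p : p \in tau_seq ->
  reduces (pif (x ^+ (34 - p.1)))^-1 (pif (x' ^+ (34 - p.1)))^-1.
Proof.
move=> p_tau; apply: (@reduces_inv _ _
  (pif (x ^+ p.1) * \prod_(q <- tau_seq | q != p)
                      (pif (x ^+ q.1) * pif (x ^+ (34 - q.1))))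
  (pif (x' ^+ p.1) * \prod_(q <- tau_seq | q != p)
                       (pif (x' ^+ q.1) * pif (x' ^+ (34 - q.1))))).
- apply: reducesM; first exact/reduces_pif/reducesX.
  by apply: reduces_prod => q _ _; apply: reducesM; apply/reduces_pif/reducesX.
- by rewrite -(norm_pifE x17 xN1) /norm_pif [RHS](bigD1_seq p) //= mulrCA mulrA.
- by rewrite -(norm_pifE x17' xN1') /norm_pif [RHS](bigD1_seq p) //= mulrCA mulrA.
Qed.

Lemma reduces_alphaf : reduces (alphaf x) (alphaf x').
Proof.
apply: reduces_prod => p p_tau _; apply/reducesX/reducesM; last exact: reduces_pif_inv.
exact/reduces_pif/reducesX.
Qed.

End Reduction.

(** * The order of alpha in characteristic l *)

Lemma rmorph_pif (F F' : fieldType) (f : {rmorphism F -> F'}) x :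
  f (pif x) = pif (f x).
Proof. by rewrite /pif rmorphB rmorphD rmorph1 rmorphXn. Qed.

Lemma rmorph_alphaf (F F' : fieldType) (f : {rmorphism F -> F'}) x :
  f (alphaf x) = alphaf (f x).
Proof.
rewrite /alphaf rmorph_prod; apply: eq_bigr => p _.
by rewrite rmorphXn fmorph_div !rmorph_pif !rmorphXn.
Qed.

(** Since l^16 is 1 modulo 34, the 16-th iterate of the Frobenius fixes w, hence alpha; so l^16 - 1
    is a multiple of the order of every power of alpha. *)
Lemma alphaf_order (K : fieldType) (w : K) (l s : nat) :
    prime l -> l \in [pchar K] -> coprime l 34 -> 34.-primitive_root w ->
    (alphaf w ^+ (34 ^ s)) ^+ 34 = 1 -> (alphaf w ^+ (34 ^ s)) ^+ 2 != 1 ->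
  l ^ 16 = 1 %[mod 17 ^ s.+1].
Proof.
move=> l_pr pcharKl co_l34 prim_w A34 A2.
(* With A = alpha^(34^s), b^(17^(s+1)) = A^34 = 1 and b^(17^s) = A^2 != 1, so b has order exactly
   17^(s+1). *)
pose b := alphaf w ^+ (2 ^ s.+1).
have b17 k : b ^+ (17 ^ k) = alphaf w ^+ (2 ^ s.+1 * 17 ^ k) by rewrite exprM.
have b1 : b ^+ (17 ^ s.+1) = 1 by rewrite b17 -expnMn expnSr exprM.
have bN1 : b ^+ (17 ^ s) != 1 by rewrite b17 expnSr -mulnA mulnCA -expnMn mulnC exprM.
have pow17_gt0 : (0 < 17 ^ s.+1)%N by rewrite expn_gt0.
have [m prim_b /(dvdn_pfactor _ _ (isT : prime 17))[k le_k def_m]] :=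
  prim_order_exists pow17_gt0 b1.
rewrite {}def_m in prim_b.
have {le_k} def_k : k = s.+1.
  apply/eqP; rewrite eqn_leq le_k ltnNge; apply: contra bN1 => le_ks.
  by rewrite -(prim_order_dvd prim_b) dvdn_exp2l.
have frob j : alphaf w ^+ (l ^ j) = alphaf (w ^+ (l ^ j)).
  elim: j => [|j IHj]; first by rewrite !expr1.
  by rewrite expnSr !exprM IHj -!(pFrobenius_autE pcharKl) rmorph_alphaf.
have l16 : l ^ 16 = 1 %[mod 34] by apply: (Euler_exp_totient co_l34).
have w_l16 : w ^+ (l ^ 16) = w.
  by apply/eqP; rewrite -[X in _ == X]expr1 (eq_prim_root_expr prim_w) l16.
apply/eqP; rewrite -def_k -(eq_prim_root_expr prim_b) expr1 exprAC frob.
by rewrite w_l16.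
Qed.

(** * The cyclotomic polynomial Phi_34 and the reduction of rational numbers *)

Definition Phi34 : {poly int} :=
  Poly [:: 1; -1; 1; -1; 1; -1; 1; -1; 1; -1; 1; -1; 1; -1; 1; -1; 1].

Lemma polyseq_Phi34 :
  Phi34 = [:: 1; -1; 1; -1; 1; -1; 1; -1; 1; -1; 1; -1; 1; -1; 1; -1; 1] :> seq int.
Proof. by rewrite (@PolyK _ 0). Qed.

Lemma Phi34_monic : Phi34 \is monic.
Proof. by rewrite monicE lead_coefE polyseq_Phi34. Qed.

Lemma evalz_Phi34 (F : fieldType) (x : F) : x ^+ 17 = -1 -> x != -1 -> evalz x Phi34 = 0.
Proof.
move=> x17 xN1; have /mulfI : x + 1 != 0 by rewrite addr_eq0.
apply; rewrite mulr0 -[RHS](addNr 1) -x17 /evalz /horner_eval.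
rewrite map_polyE horner_Poly polyseq_Phi34 /=; ring.
Qed.

Lemma evalz_mod_Phi34 (F : fieldType) (x : F) P : x ^+ 17 = -1 -> x != -1 ->
  evalz x (Pdiv.CommonRing.rmodp P Phi34) = evalz x P.
Proof.
move=> x17 xN1; rewrite [in RHS](Pdiv.RingMonic.rdivp_eq Phi34_monic P).
by rewrite evalzD evalzM (evalz_Phi34 x17 xN1) mulr0 add0r.
Qed.

Section Rational.

Variables (L : splittingFieldType rat) (z : L) (K : fieldType) (w : K).
Hypotheses (prim_z : 34.-primitive_root z) (prim_w : 34.-primitive_root w).
Hypothesis conj_z :
  forall c, coprime c 34 -> exists s : gal_of {:L}, s z = z ^+ c.

Let z17 := prim34_exp17 prim_z.
Let zN1 := prim34_neqN1 prim_z.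

(** Modulo Phi_34 the representing polynomial has degree at most 15, and it takes the rational value
    103^d q at all sixteen conjugates of z; hence it is a constant N. This makes the reduction of a
    rational number well defined. *)
Lemma reduces_rat (q : rat) (y : K) : reduces z w q%:A y ->
  exists d (N : int), 103%:~R ^+ d * q = N%:~R /\ 103%:~R ^+ d * y = N%:~R.
Proof.
case=> d [P []].
rewrite -(evalz_mod_Phi34 _ z17 zN1).
rewrite -(evalz_mod_Phi34 _ (prim34_exp17 prim_w) (prim34_neqN1 prim_w)).
set Q := Pdiv.CommonRing.rmodp P Phi34 => Qz Qw.
have sz_Q : (size Q <= 16)%N.
  rewrite -ltnS; have := Pdiv.CommonRing.ltn_rmodpN0 P (monic_neq0 Phi34_monic).
  by rewrite polyseq_Phi34.
pose c0 : L := 103%:~R ^+ d * q%:A.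
pose Q0 : {poly L} := map_poly intr Q - c0%:P.
pose rs := [seq z ^+ c | c <- [seq c <- iota 0 34 | coprime c 34]].
have Q0_0 : Q0 = 0.
  apply: (@roots_geq_poly_eq0 _ _ rs).
  - apply/allP=> _ /mapP[c + ->]; rewrite mem_filter => /andP[co_c _].
    have [s sz] := conj_z co_c; apply/rootP.
    rewrite -sz hornerD hornerN hornerC; apply/eqP; rewrite subr_eq0; apply/eqP.
    transitivity (s (evalz z Q)).
      rewrite /evalz /horner_eval -horner_map -map_poly_comp; congr _.[_].
      by apply: eq_map_poly => a /=; rewrite rmorph_int.
    have sq : s q%:A = q%:A by rewrite linearZZ rmorph1.
    rewrite -Qz /c0 rmorphM; congr (_ * _); last exact: sq.
    by rewrite rmorphXn rmorph_int.
  - rewrite map_inj_in_uniq ?filter_uniq ?iota_uniq // => c1 c2.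
    rewrite !mem_filter !mem_iota => /and3P[_ _ lt1] /and3P[_ _ lt2] /eqP.
    by rewrite (eq_prim_root_expr prim_z) !modn_small // => /eqP.
  - rewrite size_map; apply: leq_trans (size_polyD _ _) _.
    rewrite size_polyN geq_max (leq_trans (size_poly _ _)) //=.
    exact: leq_trans (size_polyC_leq1 _) _.
have Q_const : Q = (Q`_0)%:P.
  apply/polyP=> i; rewrite coefC; case: eqP => [->//|/eqP nz_i].
  have := congr1 (fun p : {poly L} => p`_i) Q0_0.
  rewrite coef0 coefB coefC (negbTE nz_i) subr0 coef_map /= => /eqP.
  rewrite -[_%:~R](@rmorph_int _ _ (in_alg L)) fmorph_eq0 intr_eq0.
  by move/eqP.
exists d, Q`_0; split.
  apply: (@fmorph_inj _ _ (in_alg L)).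
  rewrite rmorphM rmorphXn !rmorph_int /= Qz Q_const coefC /=.
  by rewrite /evalz map_polyC /horner_eval hornerC.
by rewrite Qw Q_const coefC /= /evalz map_polyC /horner_eval hornerC.
Qed.

Lemma prime_to_denq_div103 (M : nat) (N : int) d q : coprime 103 M ->
  103%:~R ^+ d * q = N%:~R -> prime_to_denq M q.
Proof.
move=> co_M qN; rewrite /prime_to_denq.
suff: (`|denq q| %| 103 ^ d)%N by move/coprime_dvdl; apply; rewrite coprimeXl.
have qE : (103 ^+ d * numq q = N * denq q :> int).
  apply: (@intr_inj rat); rewrite !rmorphM rmorphXn /= -qN -mulrA; congr (_ * _).
  by rewrite numqE.
have: (denq q %| 103 ^+ d * numq q)%Z by rewrite qE dvdz_mull.
rewrite Gauss_dvdzl; last by rewrite coprimez_sym; apply: coprime_num_den.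
by rewrite dvdzE abszX.
Qed.

(** For 103^d q = N, comparison in K shows that M divides N - 103^d a; the quotient divided by 103^d
    is the witness t. *)
Lemma eqmodQ_reduces (M : nat) (x : L) (y : K) (a : int) :
    prime M -> M \in [pchar K] -> coprime 103 M -> x \in 1%VS ->
    reduces z w x y -> y = a%:~R -> eqmodQ M x a.
Proof.
move=> M_pr pcharM co_M /vlineP[q ->] /reduces_rat[d [N [qN yN]]] ya.
have /dvdzP[k def_N] : (M %| N - 103 ^+ d * a)%Z.
  rewrite (dvdz_pcharf pcharM) rmorphB rmorphM rmorphXn /= -yN ya.
  by rewrite subrr.
have nz103 : 103%:~R ^+ d != 0 :> rat by rewrite expf_neq0.
pose t : rat := k%:~R / 103%:~R ^+ d.
have tk : 103%:~R ^+ d * t = k%:~R by rewrite mulrC divfK.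
exists q, t; split=> //.
- exact: prime_to_denq_div103 co_M qN.
- exact: prime_to_denq_div103 co_M tk.
apply: (mulfI nz103); rewrite mulrCA tk mulrBr qN.
have := congr1 (fun b => b%:~R : rat) def_N.
by rewrite rmorphB !rmorphM rmorphXn /= mulrC => ->; rewrite mulrC.
Qed.

(** Multiplying the congruence by 103^d and [denq t] gives an equation between integers; read in K
    its right side vanishes, while 103 and [denq t] stay invertible. *)
Lemma reduces_eqmodQ (M l : nat) (x : L) (y : K) (a : int) :
    prime l -> l \in [pchar K] -> (l %| M)%N -> 103%:R != 0 :> K ->
    reduces z w x y -> eqmodQ M x a -> y = a%:~R.
Proof.
move=> l_pr pcharl dvd_l K103 xy [q [t [def_x co_q co_t qt]]].
have [d [N [qN yN]]] : exists d (N : int),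
    103%:~R ^+ d * q = N%:~R /\ 103%:~R ^+ d * y = N%:~R.
  by apply: reduces_rat; rewrite -def_x.
have M0 : M%:R = 0 :> K by apply/eqP; rewrite -(dvdn_pcharf pcharl).
have eqN : denq t * (N - 103 ^+ d * a) = 103 ^+ d * (M%:Z * numq t) :> int.
  apply: (@intr_inj rat); rewrite !(rmorphM, rmorphB, rmorphXn) /= numqE -qN.
  by rewrite -mulrBr qt -[M%:~R]/(M%:R); ring.
have /eqP := congr1 (fun a => a%:~R : K) eqN.
rewrite !(rmorphM, rmorphB, rmorphXn) /= -[M%:~R]/(M%:R) M0 mul0r mulr0.
rewrite mulf_eq0 -(dvdz_pcharf pcharl) dvdzE /=.
have /negbTE-> /= : ~~ (l %| `|denq t|)%N.
  rewrite -prime_coprime // coprime_sym.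
  by move: co_t; rewrite /prime_to_denq; apply: coprime_dvdr.
rewrite -yN -mulrBr mulf_eq0 expf_eq0 -[103%:~R]/(103%:R) (negbTE K103) andbF.
by rewrite subr_eq0 => /eqP.
Qed.

End Rational.

(** * The complex root of unity zeta_34 *)

Lemma zetaC34_exp17 (R : realType) : zetaC R 34 ^+ 17 = -1.
Proof.
have deMoivre (t : R) k :
    ((cos t +i* sin t) ^+ k = cos (k%:R * t) +i* sin (k%:R * t))%C.
  elim: k => [|k IHk]; first by rewrite expr0 mul0r cos0 sin0.
  rewrite exprS IHk -natr1 mulrDl mul1r addrC cosD sinD.
  have cM (a b c d : R) :
    ((a +i* b) * (c +i* d) = (a * c - b * d) +i* (a * d + b * c))%C by [].
  by rewrite cM; congr (_ +i* _)%C; ring.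
rewrite /zetaC deMoivre.
have ->: 17%:R * (2 * pi / 34%:R) = pi :> R by field.
by rewrite cospi sinpi; apply/eqP; rewrite eq_complex /= oppr0 !eqxx.
Qed.

Lemma zetaC34_prim (R : realType) : 34.-primitive_root (zetaC R 34).
Proof.
apply: exp17_prim34; first by rewrite pnatr_eq0.
  exact: zetaC34_exp17.
rewrite eq_complex /= negb_and oppr0; apply/orP; right.
rewrite gt_eqF // sin_gt0_pi //; have pi0 := pi_gt0 R; apply/andP; split.
  by rewrite divr_gt0 ?mulr_gt0.
by rewrite ltr_pdivrMr // mulrC ltr_pM2l // ltr_nat.
Qed.

Lemma zetaC_conj (R : realType) (m : nat) : zetaC R m * (zetaC R m)^* = 1.
Proof.
by rewrite -normCK normc_def /zetaC /= cos2Dsin2 sqrtr1 expr1n.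
Qed.

(** * Conjugates of alpha and their traces *)

Section Alphaf.

Variables (F : fieldType) (x : F).
Hypothesis x34 : x ^+ 34 = 1.

Lemma exp34_mod e e' : e = e' %[mod 34] -> x ^+ e = x ^+ e'.
Proof. by move=> ee'; rewrite -(expr_mod _ x34) ee' expr_mod. Qed.

(** Replacing x by x^33 = x^-1 exchanges the exponents c and 34 - c, hence numerators and
    denominators. *)
Lemma alphaf_inv : alphaf (x ^+ 33) = (alphaf x)^-1.
Proof.
rewrite /alphaf -prodfV; apply: eq_big_seq => p p_tau.
rewrite -exprVn invf_div -!exprM; congr ((pif _ / pif _) ^+ _); apply: exp34_mod;
by apply/eqP; move: p p_tau; apply/allP.
Qed.

End Alphaf.

(** At x = z and N = 34^k this is alpha_1^(k), because complex conjugation inverts alpha; written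
    so, it makes sense over any field. *)
Definition trace_alphaf (F : fieldType) (N : nat) (x : F) : F :=
  alphaf x ^+ N + (alphaf x ^+ N)^-1.

Lemma rmorph_trace_alphaf (F F' : fieldType) (f : {rmorphism F -> F'}) N x :
  f (trace_alphaf N x) = trace_alphaf N (f x).
Proof. by rewrite /trace_alphaf rmorphD fmorphV rmorphXn rmorph_alphaf. Qed.

Lemma trace_alphaf_inv (F : fieldType) (x : F) N : x ^+ 34 = 1 ->
  trace_alphaf N (x ^+ 33) = trace_alphaf N x.
Proof.
by move=> x34; rewrite /trace_alphaf alphaf_inv // exprVn invrK addrC.
Qed.

Lemma reduces_trace_alphaf (F K : fieldType) (z : F) (w : K) N i :
    34.-primitive_root z -> 34.-primitive_root w -> coprime i 34 ->
    103%:R != 0 :> F -> 103%:R != 0 :> K ->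
  reduces z w (trace_alphaf N (z ^+ i)) (trace_alphaf N (w ^+ i)).
Proof.
move=> prim_z prim_w co_i F103 K103.
have prim_zi := prim_root_exp_coprime i prim_z; rewrite co_i in prim_zi.
have prim_wi := prim_root_exp_coprime i prim_w; rewrite co_i in prim_wi.
have red j : coprime j 34 -> reduces z w (alphaf (z ^+ j)) (alphaf (w ^+ j)).
  move=> co_j; have pz : 34.-primitive_root (z ^+ j) by rewrite prim_root_exp_coprime.
  have pw : 34.-primitive_root (w ^+ j) by rewrite prim_root_exp_coprime.
  apply: reduces_alphaf => //; try exact: prim34_exp17; try exact: prim34_neqN1.
  exact/reducesX/reduces_gen.
rewrite /trace_alphaf -!exprVn -(alphaf_inv (prim_expr_order prim_zi)).
rewrite -(alphaf_inv (prim_expr_order prim_wi)).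
apply: reducesD; apply: reducesX; first exact: red.
by rewrite -!exprM; apply: red; rewrite coprimeMl co_i.
Qed.

(* z^c and z^-c have the same trace, so an odd exponent matters only up to sign
   modulo 34. *)
Definition fold34 (e : nat) : nat :=
  (if e %% 34 < 17 then (e %% 34)./2 else (34 - e %% 34)./2)%N.

Lemma trace_alphaf_fold (F : fieldType) (x : F) N e : x ^+ 34 = 1 -> odd e ->
  trace_alphaf N (x ^+ e) = trace_alphaf N (x ^+ (2 * fold34 e + 1)).
Proof.
move=> x34 odd_e; rewrite /fold34.
have odd_m : odd (e %% 34) by rewrite odd_mod.
case: ltnP => _.
  by rewrite -(expr_mod _ x34); congr (trace_alphaf _ (_ ^+ _)); lia.
rewrite -[LHS]trace_alphaf_inv; last by rewrite exprAC x34 expr1n.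
rewrite -exprM; congr (trace_alphaf _ _); apply: exp34_mod => //.
by have := ltn_pmod e (isT : (0 < 34)%N); lia.
Qed.

(** Multiplication by c permutes the units modulo 34 taken up to sign, for which 1, 3, ..., 15 are
    representatives. *)
Lemma mesym_trace_alphaf_conj (F : fieldType) (x : F) N c j :
    x ^+ 34 = 1 -> coprime c 34 -> (j <= 8)%N ->
  (mesym 8 F j).@[fun i : 'I_8 => trace_alphaf N (x ^+ c ^+ (2 * i + 1))]
  = (mesym 8 F j).@[fun i : 'I_8 => trace_alphaf N (x ^+ (2 * i + 1))].
Proof.
move=> x34 co_c j8.
wlog c_lt : c co_c / (c < 34)%N.
  move=> H; rewrite -(expr_mod c x34); apply: H; last by rewrite ltn_mod.
  by rewrite /coprime gcdn_modl.
have : all (fun c => coprime c 34 ==> uniq [seq fold34 (c * (2 * i + 1)) | i <- iota 0 8]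
     && all (fun i => odd (c * (2 * i + 1)) && (fold34 (c * (2 * i + 1)) < 8)%N) (iota 0 8))
     (iota 0 34) by vm_compute.
move=> /allP/(_ c); rewrite mem_iota => /(_ c_lt)/implyP/(_ co_c)/andP[u_f f_lt].
move/allP: f_lt => f_lt.
have f8 (i : 'I_8) : odd (c * (2 * i + 1)) && (fold34 (c * (2 * i + 1)) < 8)%N.
  by apply: (f_lt i); rewrite mem_iota /= add0n.
pose f (i : 'I_8) : 'I_8 := Ordinal (proj2 (andP (f8 i))).
have f_inj : injective f.
  move=> i1 i2 /(congr1 val) /= eq_f; apply/val_inj.
  have /(uniqP 0%N) := u_f.
  have n_f (i : 'I_8) : nth 0%N [seq fold34 (c * (2 * i + 1)) | i <- iota 0 8] i
      = fold34 (c * (2 * i + 1)).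
    by rewrite (nth_map 0%N) ?size_iota // nth_iota.
  by move/(_ i1 i2); rewrite !n_f !inE size_map size_iota; apply.
(* As coefficients of a product of linear factors, the symmetric functions can be reindexed by the
   permutation f. *)
apply: (mulfI (_ : (-1) ^+ j != 0)); first by rewrite signr_eq0.
rewrite -!coef_prod_XsubC // [in RHS](reindex_inj f_inj) /=.
congr (polyseq _)`__; apply: eq_bigr => i _.
have /andP[odd_e _] := f8 i.
by rewrite -exprM trace_alphaf_fold.
Qed.

(** * Galois invariants and exponents in the group ring *)

Lemma mem1_gal_fixed (L : splittingFieldType rat) (x : L) :
  (forall s : gal_of {:L}, s x = x) -> x \in 1%VS.
Proof.
move=> fix_x; have gal1 : galois 1 {:L}.
  rewrite /galois sub1v normalFieldf andbT /=.
  by apply/separableP=> y _; apply: pcharf0_separable => p; rewrite pchar_lalg pchar_num.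
rewrite -(galois_fixedField gal1); apply/fixedFieldP; first exact: memvf.
by move=> s _.
Qed.

Section GroupRingExponent.

Variables (L : splittingFieldType rat) (b : L).
Hypothesis nz_b : b != 0.

Lemma galring_expD (t u : galring L) :
  galring_exp b (t + u) = galring_exp b t * galring_exp b u.
Proof.
rewrite /galring_exp -big_split; apply: eq_bigr => s _ /=.
by rewrite ffunE expfzDr // fmorph_eq0.
Qed.

(** Nested to the right, to match the unfolded product over [tau_seq]. *)
Lemma galring_expD8 (t1 t2 t3 t4 t5 t6 t7 t8 : galring L) :
  let e := galring_exp b in
  e (t1 + t2 + t3 + t4 + t5 + t6 + t7 + t8)
  = e t1 * (e t2 * (e t3 * (e t4 * (e t5 * (e t6 * (e t7 * e t8)))))).
Proof. by rewrite /= !galring_expD !mulrA. Qed.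

Lemma galring_exp_elt (s : gal_of {:L}) : s \in 'Gal({:L} / 1)%g ->
  galring_exp b (galring_elt s) = s b.
Proof.
move=> s_gal; rewrite /galring_exp (bigD1 s) //= ffunE eqxx expr1z big1 ?mulr1 //.
by move=> t /andP[_ /negbTE neq_ts]; rewrite ffunE neq_ts expr0z.
Qed.

Lemma galring_exp_elt_mul (s : gal_of {:L}) k : s \in 'Gal({:L} / 1)%g ->
  galring_exp b (galring_elt s *+ k) = s b ^+ k.
Proof.
move=> s_gal; elim: k => [|k IHk].
  by rewrite mulr0n /galring_exp big1 // => t _; rewrite ffunE expr0z.
by rewrite mulrS galring_expD galring_exp_elt // IHk exprS.
Qed.

End GroupRingExponent.

Lemma coprime_odd34 (i : 'I_8) : coprime (2 * i + 1) 34.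
Proof.
have: all (fun k => coprime (2 * k + 1) 34) (iota 0 8) by vm_compute.
by move/allP/(_ i); apply; rewrite mem_iota /= add0n.
Qed.

(** * The given Galois data expressed through [alphaf] *)

Section Glue.

Variables (R : realType) (L : splittingFieldType rat) (iota : {rmorphism L -> R[i]}) (z : L).
Hypothesis z_def : iota z = zetaC R 34.
Variables (bar : L -> L) (sigma : int -> gal_of {:L}).
Hypothesis bar_def : forall x, iota (bar x) = (iota x)^*.
Hypothesis sigma_def : forall c : int, coprimez c 34 ->
  sigma c \in 'Gal({:L} / 1)%g /\ sigma c z = z ^ c.

Lemma prim_zeta34 : 34.-primitive_root z.
Proof. by rewrite -(fmorph_primitive_root iota) z_def zetaC34_prim. Qed.

Let z34 : z ^+ 34 = 1 := prim_expr_order prim_zeta34.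

Lemma zeta34_neq0 : z != 0.
Proof.
by apply: contra_eq_neq z34 => ->; rewrite expr0n eq_sym oner_neq0.
Qed.

Lemma conj_zeta34 : (iota z)^* = iota (z ^+ 33).
Proof.
have nz : iota z != 0 by rewrite fmorph_eq0 zeta34_neq0.
apply: (mulfI nz); rewrite -rmorphM -exprS z34 rmorph1 z_def.
exact: zetaC_conj.
Qed.

Lemma L103 : 103%:R != 0 :> L.
Proof. by rewrite -(fmorph_eq0 iota) rmorph_nat pnatr_eq0. Qed.

Lemma pi_E : pi_ z = pif z.
Proof.
rewrite /pi_ /pif -!exprM -[(2 * 9)%N]/(17.+1)%N exprS.
by rewrite (prim34_exp17 prim_zeta34) mulrN1.
Qed.

Lemma bar_piE : bar (pi_ z) = pif (z ^+ 33).
Proof.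
by apply: (fmorph_inj iota); rewrite bar_def pi_E !rmorph_pif -conj_zeta34.
Qed.

Lemma bar_alphafX N : bar (alphaf z) ^+ N = (alphaf z ^+ N)^-1.
Proof.
rewrite -exprVn -alphaf_inv //; congr (_ ^+ N); apply: (fmorph_inj iota).
by rewrite bar_def !rmorph_alphaf -conj_zeta34.
Qed.

Lemma conj_z c : coprime c 34 -> exists s : gal_of {:L}, s z = z ^+ c.
Proof. by move=> co_c; exists (sigma c); case: (sigma_def (c := c)). Qed.

Lemma alphaE : alpha z bar sigma = alphaf z.
Proof.
(* The negative indices in tau are turned into the residues between 0 and 34 used by [tau_seq]. *)
have zN e e' : (e + e')%N = 34%N -> z ^ (- e%:Z) = z ^+ e'.
  move=> def_e; apply: (mulfI (expf_neq0 e zeta34_neq0)); rewrite -exprD def_e z34.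
  by rewrite -[z ^+ e]/(z ^ e%:Z) -expfzDr ?zeta34_neq0 // subrr expr0z.
rewrite /alpha bar_piE pi_E.
set b := pif z / _.
have nz_b : b != 0.
  have p1 : (1, 1)%N \in tau_seq by [].
  have [nz1 nz2] := pif_neq0 (prim34_exp17 prim_zeta34) (prim34_neqN1 prim_zeta34) L103 p1.
  by rewrite mulf_neq0 ?invr_eq0.
have sb c e : coprimez c 34 -> z ^ c = z ^+ e -> (e <= 34)%N ->
    sigma c b = pif (z ^+ e) / pif (z ^+ (34 - e)).
  move=> co_c zc le_e; have [_ sz] := sigma_def co_c.
  rewrite /b fmorph_div; congr (_ / _); first by rewrite -zc -sz; apply: rmorph_pif.
  transitivity (pif (sigma c z ^+ 33)); first by rewrite rmorph_pif rmorphXn.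
  by rewrite sz zc -exprM; congr pif; apply: exp34_mod => //; lia.
have ge c e k (co_c : coprimez c 34) (zc : z ^ c = z ^+ e) (le_e : (e <= 34)%N) :
    galring_exp b (galring_elt (sigma c) *+ k) = (pif (z ^+ e) / pif (z ^+ (34 - e))) ^+ k.
  by rewrite (galring_exp_elt_mul nz_b _ (proj1 (sigma_def co_c))) (sb _ _ co_c zc le_e).
rewrite /alphaf /tau_seq 8!big_cons big_nil mulr1 /tau_ (galring_expD8 nz_b).
do 7?[congr (_ * _)].
- by rewrite (galring_exp_elt b (proj1 (sigma_def (isT : coprimez 1 34)))) (sb 1 1%N).
- exact: (ge (-11) 23%N _ isT (zN 11%N 23%N erefl) isT).
- exact: (ge 7 7%N _ isT erefl isT).
- exact: (ge 5 5%N _ isT erefl isT).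
- exact: (ge (-15) 19%N _ isT (zN 15%N 19%N erefl) isT).
- exact: (ge (-3) 31%N _ isT (zN 3%N 31%N erefl) isT).
- exact: (ge (-13) 21%N _ isT (zN 13%N 21%N erefl) isT).
- exact: (ge (-9) 25%N _ isT (zN 9%N 25%N erefl) isT).
Qed.

Lemma S_E k j : S_ z bar sigma k j
  = (mesym 8 L j).@[fun i : 'I_8 => trace_alphaf (34 ^ k) (z ^+ (2 * i + 1))].
Proof.
rewrite /S_ !mevalmesymE; apply: eq_bigr => h _; apply: eq_bigr => i _.
rewrite /alpha_ alphaE bar_alphafX.
have co_i : coprimez (2 * i + 1)%N 34.
  by have := coprime_odd34 i.
have [_ sz] := sigma_def co_i.
transitivity (trace_alphaf (34 ^ k) (sigma (2 * i + 1)%N z)); last by rewrite sz.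
exact: rmorph_trace_alphaf.
Qed.

(** Every automorphism sends z to some z^c with c prime to 34, and so only permutes the eight
    arguments. *)
Lemma S_rational k j : (j <= 8)%N -> S_ z bar sigma k j \in 1%VS.
Proof.
move=> j8; apply: mem1_gal_fixed => s; rewrite S_E.
have prim_sz : 34.-primitive_root (s z) by rewrite fmorph_primitive_root prim_zeta34.
have [c sz] := prim_rootP prim_zeta34 (prim_expr_order prim_sz).
have co_c : coprime c 34 by rewrite -(prim_root_exp_coprime c prim_zeta34) -sz.
have sX m : s (z ^+ m) = z ^+ c ^+ m by rewrite -sz; apply: rmorphXn.
rewrite -[RHS](mesym_trace_alphaf_conj _ z34 co_c j8) !mevalmesymE rmorph_sum.
apply: eq_bigr => h _; rewrite rmorph_prod; apply: eq_bigr => i _.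
transitivity (trace_alphaf (34 ^ k) (s (z ^+ (2 * i + 1)))).
  exact: rmorph_trace_alphaf.
by rewrite sX.
Qed.

End Glue.

(** * Arithmetic of M *)

(** Repeated squaring moves 34 around a cycle of eight residues modulo 103. Here 82, 101, 94 and 73
    stand for -21, -2, -9 and -30. *)
Lemma Mn_mod103 n : (1 <= n)%N ->
  (Mn n %% 103)%N \in [:: 82; 15; 35; 24; 101; 94; 10; 73]%N.
Proof.
move=> n_gt0; rewrite /Mn -modnDml.
have : (34 ^ (2 ^ n) %% 103)%N \in [:: 81; 14; 34; 23; 100; 93; 9; 72]%N.
  elim: n n_gt0 => // [[|n] IHn] _; first by [].
  rewrite expnSr expnM -modnXm; move: (IHn isT); set a := (_ %% _)%N.
  rewrite !inE; do 7!(case/orP => [/eqP->|]; first by []); by move/eqP->.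
rewrite !inE; do 7!(case/orP => [/eqP->|]; first by []); by move/eqP->.
Qed.

Lemma Mn_coprime103 n : (1 <= n)%N -> coprime 103 (Mn n).
Proof.
move=> n_gt0; rewrite prime_coprime // /dvdn.
by apply: contraTneq (Mn_mod103 n_gt0) => ->.
Qed.

Lemma Mn_eq34 n : (1 <= n)%N -> Mn n = (34 * 34 ^ (2 ^ n - 2).+1 + 1)%N.
Proof.
move=> n_gt0; rewrite /Mn -expnS; congr (_ ^ _ + 1)%N.
by rewrite subnSK ?(ltn_exp2l 0) // subn1 prednK ?expn_gt0.
Qed.

Lemma Mn_coprime34 n : (1 <= n)%N -> coprime 34 (Mn n).
Proof.
by move=> /Mn_eq34->; rewrite /coprime -gcdn_modr mulnC modnMDl.
Qed.

(** Rests on 34 < 17^2; it puts the least prime factor of a composite M below 17^r. *)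
Lemma pow34_lt r : (0 < r)%N -> (34 ^ r + 1 < (17 ^ r) ^ 2)%N.
Proof.
rewrite -expnM mulnC expnM; case: r => // k _.
elim: k => [|k IHk]; first by rewrite !expn1.
rewrite (expnS 34) (expnS (17 ^ 2)).
move: IHk; set a := (34 ^ _)%N; set b := ((17 ^ 2) ^ _)%N.
by rewrite -[(17 ^ 2)%N]/289%N; lia.
Qed.

(** [false] is case (i) and [true] is case (ii); the entry of index 0 is the empty symmetric
    function. *)
Definition esymZ (b : bool) (j : nat) : int :=
  if b then [:: 1; 1; -7; -6; 15; 10; -10; -4; 1]`_j
  else [:: 1; -1; -7; 6; 15; -10; -10; 4; 1]`_j.

Lemma esymZ_esym17 (F : fieldType) (b : bool) j : (1 <= j <= 8)%N ->
  esym17 ((-1) ^+ b) j = (esymZ b j)%:~R :> F.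
Proof.
case/andP=> _ j8; rewrite /esym17 /esymZ.
by case: b; move: j8; do 9?[case: j => [|j] //=] => _; ring.
Qed.

Lemma sign_pm1 (F : fieldType) (b : bool) :
  (-1) ^+ b = 1 :> F \/ (-1) ^+ b = -1 :> F.
Proof. by case: b; [right | left]. Qed.

(** * From primality to the congruences, and from the congruences to the prime factors of M *)

Section Criterion.

Variables (R : realType) (L : splittingFieldType rat) (iota : {rmorphism L -> R[i]}) (z : L).
Hypothesis z_def : iota z = zetaC R 34.
Variables (bar : L -> L) (sigma : int -> gal_of {:L}).
Hypothesis bar_def : forall x, iota (bar x) = (iota x)^*.
Hypothesis sigma_def : forall c : int, coprimez c 34 ->
  sigma c \in 'Gal({:L} / 1)%g /\ sigma c z = z ^ c.
Variables (n : nat) (n_gt0 : (1 <= n)%N).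

Let r := (2 ^ n)%N.
Let M := Mn n.
Let S := S_ z bar sigma (r - 1).

Lemma reduces_S (K : fieldType) (w : K) j :
    34.-primitive_root w -> 103%:R != 0 :> K ->
  reduces z w (S j)
    (mesym 8 K j).@[fun i : 'I_8 => trace_alphaf (34 ^ (r - 1)) (w ^+ (2 * i + 1))].
Proof.
move=> prim_w K103; rewrite /S (S_E z_def bar_def sigma_def) !mevalmesymE.
apply: reduces_sum => h _; apply: reduces_prod => i _ _.
apply: reduces_trace_alphaf => //.
- exact: prim_zeta34 z_def.
- exact: coprime_odd34.
- exact: L103 iota.
Qed.

Lemma prime_eqmodQ : prime M -> forall j, (1 <= j <= 8)%N ->
  eqmodQ M (S j) (esymZ ((M %% 103)%N \notin [:: 82; 15]%N) j).
Proof.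
move=> M_pr j j8; set b := (_ \notin _).
have co103 := Mn_coprime103 n_gt0; have co34 := Mn_coprime34 n_gt0.
have coN : coprime (34 * 103) M by rewrite coprimeMl co34 co103.
(* Powers of one root of unity of order 34 * 103 provide both w and the root for the Gauss sum. *)
have [K [pcharM [W prim_W]]] := @finField_prim_root M (34 * 103) M_pr isT coN.
have dvd34 : (34 %| 34 * 103)%N by apply: dvdn_mulr.
have dvd103 : (103 %| 34 * 103)%N by apply: dvdn_mull.
have prim_w := dvdn_prim_root prim_W dvd34.
have prim_om := dvdn_prim_root prim_W dvd103.
set w := W ^+ _ in prim_w; set om := W ^+ _ in prim_om.
have M103 : ~~ (103 %| M)%N by rewrite -prime_coprime.
have K103 : 103%:R != 0 :> K.
  rewrite -(dvdn_pcharf pcharM) -prime_coprime //.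
  by rewrite coprime_sym.
apply: (eqmodQ_reduces (prim_zeta34 z_def) prim_w (conj_z sigma_def) M_pr pcharM co103).
- by apply: (S_rational z_def bar_def sigma_def); case/andP: j8.
- exact: reduces_S.
rewrite -esymZ_esym17 //.
pose u := w ^+ ind78 (M %% 103).
transitivity (mesym 8 K j).@[fun i : 'I_8 => u ^+ (2 * i + 1) + (u ^+ (2 * i + 1))^-1].
  rewrite !mevalmesymE; apply: eq_bigr => h _; apply: eq_bigr => i _.
  have prim_wi : 34.-primitive_root (w ^+ (2 * i + 1)).
    by rewrite prim_root_exp_coprime ?coprime_odd34.
  (* Taking w^(2i+1) in place of w shows that this conjugate of alpha^(34^(r-1)) is the inverse of
     u^(2i+1). *)
  have := alphaf_pow_chi prim_wi prim_om M_pr pcharM (Mn_eq34 n_gt0) M103.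
  have -> : (2 ^ n - 2).+1 = (r - 1)%N.
    by rewrite subnSK // (ltn_exp2l 0).
  rewrite exprAC -/u => uA; rewrite /trace_alphaf.
  set A := alphaf _ ^+ _; have uA1 : u ^+ (2 * i + 1) * A = 1 by [].
  have nz_u : u ^+ (2 * i + 1) != 0.
    by apply: contra_eq_neq uA1 => ->; rewrite mul0r eq_sym oner_neq0.
  have -> : A = (u ^+ (2 * i + 1))^-1 by apply: (mulfI nz_u); rewrite uA1 divff.
  by rewrite invrK addrC.
apply: prim17_esym => //; first exact: sign_pm1.
have {u}-> : (-1) ^+ b * u = w ^+ (17 * b + ind78 (M %% 103)).
  by rewrite exprD exprM (prim34_exp17 prim_w).
have := Mn_mod103 n_gt0; rewrite -/M /b; set m := (M %% 103)%N => m_in.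
(* For each of the eight residues of M the exponent has gcd 2 with 34, so (-1)^b u has order 17. *)
have : (34 %/ gcdn (17 * (m \notin [:: 82; 15]%N) + ind78 m) 34 = 17)%N.
  move: m_in; rewrite !inE; do 7!(case/orP => [/eqP->|]; first by []); by move/eqP->.
set k := (17 * _ + _)%N => eq17; rewrite -eq17.
exact: exp_prim_root.
Qed.

Lemma eqmodQ_order (b : bool) l : (forall j, (1 <= j <= 8)%N -> eqmodQ M (S j) (esymZ b j)) ->
  prime l -> (l %| M)%N -> l ^ 16 = 1 %[mod 17 ^ r].
Proof.
move=> S_eq l_pr dvd_l.
have co103 := Mn_coprime103 n_gt0; have co34 := Mn_coprime34 n_gt0.
have co34l : coprime 34 l := coprime_dvdr dvd_l co34.
have [K [pcharl [w prim_w]]] := @finField_prim_root l 34 l_pr isT co34l.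
have coK m : coprime m l -> m%:R != 0 :> K.
  by move=> co_m; rewrite -(dvdn_pcharf pcharl) -prime_coprime // coprime_sym.
have K103 : 103%:R != 0 :> K by apply: coK; apply: coprime_dvdr dvd_l co103.
have K2 : 2%:R != 0 :> K by apply: coK; apply: coprime_dvdl co34l.
have K17 : 17%:R != 0 :> K by apply: coK; apply: coprime_dvdl co34l.
have e_eq j : (1 <= j <= 8)%N ->
    (mesym 8 K j).@[fun i : 'I_8 => trace_alphaf (34 ^ (r - 1)) (w ^+ (2 * i + 1))]
    = esym17 ((-1) ^+ b) j.
  move=> j8; rewrite esymZ_esym17 //.
  by apply: (reduces_eqmodQ (prim_zeta34 z_def) prim_w (conj_z sigma_def) l_pr
    pcharl dvd_l K103 (reduces_S j prim_w K103)); apply: S_eq.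
have w17 := prim34_exp17 prim_w; have wN1 := prim34_neqN1 prim_w.
have nz_alpha : alphaf w ^+ (34 ^ (r - 1)) != 0.
  apply: expf_neq0; rewrite prodf_seq_neq0; apply/allP => p p_tau.
  have [nz1 nz2] := pif_neq0 w17 wN1 K103 p_tau.
  by rewrite expf_neq0 ?mulf_neq0 ?invr_eq0.
(* The entry of index 0 has exponent 2 * 0 + 1 = 1, so it is A + A^-1 for A = alpha^(34^(r-1)). *)
have [|A34 A2] := esym17_root (sign_pm1 K b) nz_alpha K2 K17 _ e_eq.
  by rewrite /trace_alphaf expr1.
have := alphaf_order l_pr pcharl _ prim_w A34 A2.
rewrite subn1 prednK ?expn_gt0 // coprime_sym; exact.
Qed.

End Criterion.

Theorem proposition4p6 (R : realType)
    (L : splittingFieldType rat) (iota : {rmorphism L -> R[i]}) (z : L)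
    (z_def : iota z = zetaC R 34) (L_gen : <<1; z>>%VS = fullv)
    (bar : L -> L) (bar_def : forall x, iota (bar x) = (iota x)^*)
    (sigma : int -> gal_of {:L})
    (sigma_def : forall c : int, coprimez c 34 ->
       sigma c \in 'Gal({:L} / 1)%g /\ sigma c z = z ^ c)
    (n : nat) (n_gt0 : (1 <= n)%N) :
  let r := (2 ^ n)%N in
  let M := Mn n in
  let S := S_ z bar sigma (r - 1)%N in
  (forall x : nat, (1 < x < 17 ^ r)%N -> x ^ 16 = 1 %[mod 17 ^ r] ->
     ~~ (x %| M)%N) ->
  prime M <->
    (exists2 a : int, a \in [:: -21; 15] & (M = a %[mod 103])%Z)
    /\ [/\ eqmodQ M (S 1%N) (-1), eqmodQ M (S 2%N) (-7),
           eqmodQ M (S 3%N) 6 & eqmodQ M (S 4%N) 15]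
    /\ [/\ eqmodQ M (S 5%N) (-10), eqmodQ M (S 6%N) (-10),
           eqmodQ M (S 7%N) 4 & eqmodQ M (S 8%N) 1]
  \/
    (exists2 a : int, a \in [:: 35; 24; -2; -9; 10; -30]
                    & (M = a %[mod 103])%Z)
    /\ [/\ eqmodQ M (S 1%N) 1, eqmodQ M (S 2%N) (-7),
           eqmodQ M (S 3%N) (-6) & eqmodQ M (S 4%N) 15]
    /\ [/\ eqmodQ M (S 5%N) 10, eqmodQ M (S 6%N) (-10),
           eqmodQ M (S 7%N) (-4) & eqmodQ M (S 8%N) 1].
Proof.
move=> r M S no_small.
have S_prime := prime_eqmodQ z_def bar_def sigma_def n_gt0.
have S_order := eqmodQ_order z_def bar_def sigma_def n_gt0.
(* For M composite, the least prime factor l satisfies l^2 <= M < 17^(2r) and l^16 = 1 modulo 17^r,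
   so x = l contradicts [no_small]. *)
have prime_crit b : (forall j, (1 <= j <= 8)%N -> eqmodQ M (S j) (esymZ b j)) -> prime M.
  move=> S_eq; apply/negPn/negP => M_npr.
  have M_gt1 : (1 < M)%N by rewrite /M /Mn addn1 ltnS expn_gt0.
  have pr_l := pdiv_prime M_gt1.
  have l16 := S_order b _ S_eq pr_l (pdiv_dvd M).
  have := no_small (pdiv M); rewrite (pdiv_dvd M) => H; have: false; last by [].
  apply: H => //; rewrite prime_gt1 //= -(ltn_exp2r _ _ (isT : (0 < 2)%N)).
  have le_l : (pdiv M ^ 2 <= M)%N.
    by rewrite leqNgt; apply: contra M_npr; apply: ltn_pdiv2_prime; apply: ltnW.
  by apply: leq_ltn_trans le_l (pow34_lt _); rewrite expn_gt0.
have modz103 (a : int) v : (M %% 103)%N = v -> (a %% 103)%Z = v%:Z ->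
    (M = a %[mod 103])%Z.
  by move=> Mv ->; rewrite -Mv modz_nat.
split=> [M_pr | [[_ [[S1 S2 S3 S4] [S5 S6 S7 S8]]] | [_ [[S1 S2 S3 S4] [S5 S6 S7 S8]]]]].
- have := S_prime M_pr; have := Mn_mod103 n_gt0; rewrite -/M.
  set b := (_ \notin _).
  (* The first two residues belong to case (i), the other six to case (ii). *)
  rewrite (_ : [:: _, _ & _]
             = [:: 82; 15] ++ [:: 35; 24; 101; 94; 10; 73])%N //.
  rewrite mem_cat => M_in S_eq; case def_b: b S_eq => S_eq; [right | left].
  + split; last by split; split; [exact: (S_eq 1%N) | exact: (S_eq 2%N) | exact: (S_eq 3%N)
      | exact: (S_eq 4%N) | exact: (S_eq 5%N) | exact: (S_eq 6%N) | exact: (S_eq 7%N)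
      | exact: (S_eq 8%N)].
    move: M_in; rewrite -[X in X || _]negbK -/b def_b /= !inE.
    case/orP=> [/eqP Mv|]; first by exists 35 => //; apply: (modz103 _ _ Mv).
    case/orP=> [/eqP Mv|]; first by exists 24 => //; apply: (modz103 _ _ Mv).
    case/orP=> [/eqP Mv|]; first by exists (-2) => //; apply: (modz103 _ _ Mv).
    case/orP=> [/eqP Mv|]; first by exists (-9) => //; apply: (modz103 _ _ Mv).
    case/orP=> [/eqP Mv|]; first by exists 10 => //; apply: (modz103 _ _ Mv).
    by move/eqP=> Mv; exists (-30) => //; apply: (modz103 _ _ Mv).
  + split; last by split; split; [exact: (S_eq 1%N) | exact: (S_eq 2%N) | exact: (S_eq 3%N)
      | exact: (S_eq 4%N) | exact: (S_eq 5%N) | exact: (S_eq 6%N) | exact: (S_eq 7%N)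
      | exact: (S_eq 8%N)].
    move/negbFE: def_b; rewrite !inE.
    case/orP=> [/eqP Mv|]; first by exists (-21) => //; apply: (modz103 _ _ Mv).
    by move/eqP=> Mv; exists 15 => //; apply: (modz103 _ _ Mv).
- by apply: (prime_crit false) => j; do 9?[case: j => [|j] //].
- by apply: (prime_crit true) => j; do 9?[case: j => [|j] //].
Qed.
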